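(* Let $q$ be a prime power, $F=\mathbb{F}_q(\!(t^{-1})\!)$, $G=PGL(3,F)$, $\Gamma=PGL(3,\mathbb{F}_q[t])$, and let $A_w^+$ be the weighted adjacency operator on $L^2_w(\Gamma\backslash\mathcal{B}(G))$ described in the context. Then the spectrum of $A_w^+$ (as a bounded operator on $L^2_w(\Gamma\backslash\mathcal{B}(G))$) contains $\Sigma_0\cup\Sigma_1\cup\Sigma_2$, where $$\Sigma_0=\{q^2+q+1,\ (q^2+q+1)e^{\frac{2\pi i}{3}},\ (q^2+q+1)e^{\frac{4\pi i}{3}}\},$$ $$\Sigma_1=\{q^{\frac{3}{2}}e^{i\theta}+qe^{-2i\theta}+q^{\frac{1}{2}}e^{i\theta}\colon \theta\in\mathbb{R}\}$$ (a hypocycloid with three cusps $(q^{3/2}+q+q^{1/2})e^{2k\pi i/3}$, $k=0,1,2$), and $$\Sigma_2=\{q(s_1+s_2+s_3)\colon s_1,s_2,s_3\in\mathbb{C},\ s_1s_2s_3=1,\ |s_1|=|s_2|=|s_3|=1\}$$ (the closed region bounded by the hypocycloid with cusps $3qe^{2k\pi i/3}$, $k=0,1,2$).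
   Context: $\mathbb{F}_q(\!(t^{-1})\!)$ is the field of formal Laurent series in $t^{-1}$ over $\mathbb{F}_q$, with valuation ring $\mathcal{O}=\mathbb{F}_q[\![t^{-1}]\!]$; $W=PGL(3,\mathcal{O})$. The vertices of the Bruhat–Tits building $\mathcal{B}(G)$ are identified with $G/W$ (homothety classes of $\mathcal{O}$-lattices in $F^3$), $\Gamma$ acting by left multiplication. For integers $m\ge n\ge 0$ put $x_{m,n}=\mathrm{diag}(t^m,t^n,1)$ and $v_{m,n}=\Gamma x_{m,n}W$; every vertex of $\Gamma\backslash\mathcal{B}(G)$ equals exactly one $v_{m,n}$. The colored adjacency operator $A^+$ on the building sends $f$ to $x\mapsto\sum f(y)$ over neighbours $y$ of $x$ with color $\tau(y)=\tau(x)+1$ (mod 3), and $A^-$ similarly with $\tau(x)-1$; on $\Gamma$-invariant functions these induce operators $A_w^\pm$ on functions $f$ on $\{v_{m,n}\}$, given explicitly by: $A_w^+f(v_{0,0})=(q^2+q+1)f(v_{1,0})$, $A_w^-f(v_{0,0})=(q^2+q+1)f(v_{1,1})$; for $m\ge1$: $A_w^+f(v_{m,0})=f(v_{m+1,0})+(q^2+q)f(v_{m,1})$, $A_w^-f(v_{m,0})=q^2f(v_{m-1,0})+(q+1)f(v_{m+1,1})$, $A_w^+f(v_{m,m})=q^2f(v_{m-1,m-1})+(q+1)f(v_{m+1,m})$, $A_w^-f(v_{m,m})=(q^2+q)f(v_{m,m-1})+f(v_{m+1,m+1})$; for $m>n\ge1$: $A_w^+f(v_{m,n})=q^2f(v_{m-1,n-1})+qf(v_{m,n+1})+f(v_{m+1,n})$,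 $A_w^-f(v_{m,n})=q^2f(v_{m-1,n})+qf(v_{m,n-1})+f(v_{m+1,n+1})$. The weight $w$ on vertices is $w(v_{0,0})=\frac{1}{q^2+q+1}$, $w(v_{m,0})=w(v_{m,m})=q^{-2m}$ for $m\ge1$, $w(v_{m,n})=(q+1)q^{-2m}$ for $m>n>0$ (equivalently $w(v_{m,n})=q^3(q+1)(q-1)^2/|\mathrm{Stab}_\Gamma(x_{m,n}W)|$), and $L^2_w(\Gamma\backslash\mathcal{B}(G))$ is the space of $f$ with $\sum_{m\ge n\ge0}|f(v_{m,n})|^2w(v_{m,n})<\infty$. On this space $A_w^\pm$ are bounded and $(A_w^+)^*=A_w^-$. *)

(* Defs.v *)
From HB Require Import structures.
From mathcomp Require Import all_boot all_order all_algebra.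
From mathcomp Require Import zify ring.
From mathcomp Require Import all_classical all_reals all_analysis.
From mathcomp Require Import generic_quotient complex.

Set Implicit Arguments.
Unset Strict Implicit.
Unset Printing Implicit Defensive.

Import Order.TTheory GRing.Theory Num.Theory.
Import numFieldNormedType.Exports.

Local Open Scope classical_set_scope.
Local Open Scope quotient_scope.
Local Open Scope ring_scope.

(* Formal Laurent series in t^-1 over K: the families of coefficients
   (the coefficient of t ^ n being lcoef f n) that vanish for n large. *)
Definition bounded_above (K : fieldType) (f : int -> K) : Prop :=
  exists N : int, forall n, N < n -> f n = 0.

Record laurent (K : fieldType) := Laurent {
  lcoef :> int -> K;
  laurentP : `[< bounded_above lcoef >]
}.

HB.instance Definition _ (K : fieldType) := [isSub for @lcoef K].
HB.instance Definition _ (K : fieldType) := [Choice of laurent K by <:].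

Section LaurentField.
Variable K : fieldType.
Implicit Types f g h : laurent K.

Definition lbd (f : int -> K) (N : int) := forall n, N < n -> f n = 0.

Lemma laurent_eq f g : (f : int -> K) =1 g -> f = g.
Proof. by move=> fg; apply: val_inj; apply/funext. Qed.

Lemma laurent_lbd f : exists N, lbd f N.
Proof. exact/asboolP/laurentP. Qed.

Lemma lbdW (f : int -> K) N M : N <= M -> lbd f N -> lbd f M.
Proof. by move=> NM fN n Mn; apply: fN; apply: le_lt_trans Mn. Qed.

Definition mkL (f : int -> K) (N : int) (fN : lbd f N) : laurent K :=
  @Laurent K f (introT (asboolP _) (ex_intro _ N fN)).

Lemma lmono_subproof (m : int) (c : K) :
  `[< bounded_above (fun n : int => if n == m then c else 0) >].
Proof. by apply/asboolP; exists m => n; case: eqP => // ->; rewrite ltxx. Qed.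
Definition lmono m c : laurent K := Laurent (lmono_subproof m c).

Lemma ladd_subproof f g : `[< bounded_above (fun n => f n + g n) >].
Proof.
apply/asboolP; have [N fN] := laurent_lbd f; have [M gM] := laurent_lbd g.
exists (Num.max N M) => n; rewrite gt_max => /andP[Nn Mn].
by rewrite fN// gM// addr0.
Qed.
Definition ladd f g : laurent K := Laurent (ladd_subproof f g).

Lemma lopp_subproof f : `[< bounded_above (fun n => - f n) >].
Proof.
apply/asboolP; have [N fN] := laurent_lbd f.
by exists N => n Nn; rewrite fN// oppr0.
Qed.
Definition lopp f : laurent K := Laurent (lopp_subproof f).

Fact laddA : associative ladd.
Proof. by move=> f g h; apply: laurent_eq => n /=; rewrite addrA. Qed.
Fact laddC : commutative ladd.
Proof. by move=> f g; apply: laurent_eq => n /=; rewrite addrC. Qed.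
Fact ladd0 : left_id (lmono 0 0) ladd.
Proof. by move=> f; apply: laurent_eq => n /=; rewrite if_same add0r. Qed.
Fact laddN : left_inverse (lmono 0 0) lopp ladd.
Proof. by move=> f; apply: laurent_eq => n /=; rewrite if_same addNr. Qed.

HB.instance Definition _ :=
  GRing.isZmodule.Build (laurent K) laddA laddC ladd0 laddN.

(* Cauchy product; the sum has finite support. *)
Definition lmul_coef f g (n : int) : K :=
  \sum_(i \in [set: int]) f i * g (n - i).

Lemma lmul_coefE f g N M k : lbd f N -> lbd g M ->
  lmul_coef f g (N + M - k%:Z) =
  \sum_(i < k.+1) f (N - i%:Z) * g (M - (k - i)%N%:Z).
Proof.
move=> fN gM; rewrite /lmul_coef.
rewrite -(@fsbig_widen _ _ 0 +%R ((fun j : nat => N - j%:Z) @` `I_k.+1))//.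
  rewrite fsbig_image; last by move=> i j _ _; lia.
  rewrite -(@fsbig_ord _ _ +%R k.+1
    (fun j : nat => f (N - j%:Z) * g (N + M - k%:Z - (N - j%:Z)))).
  apply: eq_bigr => -[i /= ik] _; congr (_ * g _); lia.
move=> i [_ Hi] /=; have [Ni|iN] := ltP N i; first by rewrite fN// mul0r.
rewrite [g _]gM ?mulr0//; rewrite ltNge; apply/negP => le_M.
by apply: Hi => /=; exists `|N - i|%N => /=; lia.
Qed.

Lemma lmul_lbd f g N M : lbd f N -> lbd g M -> lbd (lmul_coef f g) (N + M).
Proof.
move=> fN gM n NMn; apply: fsbig1 => i _.
have [Ni|iN] := ltP N i; first by rewrite fN// mul0r.
by rewrite [g _]gM ?mulr0//; lia.
Qed.

Lemma lmul_subproof f g : `[< bounded_above (lmul_coef f g) >].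
Proof.
apply/asboolP; have [N fN] := laurent_lbd f; have [M gM] := laurent_lbd g.
by exists (N + M); apply: lmul_lbd.
Qed.
Definition lmul f g : laurent K := Laurent (lmul_subproof f g).

(* the first M coefficients of f, read downwards from degree N *)
Definition ltrunc (f : int -> K) N M : {poly K} := \poly_(k < M) f (N - k%:Z).

Lemma lmul_trunc f g N1 N2 M k : lbd f N1 -> lbd g N2 -> (k < M)%N ->
  lmul f g (N1 + N2 - k%:Z) = (ltrunc f N1 M * ltrunc g N2 M)`_k.
Proof.
move=> fN gM kM; rewrite /= lmul_coefE// coefM; apply: eq_bigr => -[i /= ik] _.
by rewrite !coef_poly !ifT//; lia.
Qed.

Lemma lcoef_cases (N n : int) :
  (N < n) \/ exists k : nat, n = N - k%:Z.
Proof.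
by have [|nN] := ltP N n; [left|right; exists `|N - n|%N; lia].
Qed.

Fact lmulC : commutative lmul.
Proof.
move=> f g; apply: laurent_eq => n.
have [N fN] := laurent_lbd f; have [M gM] := laurent_lbd g.
have [NMn|[k ->]] := lcoef_cases (N + M) n.
  by rewrite /= (lmul_lbd fN gM)// (lmul_lbd gM fN)// addrC.
by rewrite (lmul_trunc fN gM (ltnSn k)) mulrC -(lmul_trunc gM fN (ltnSn k)) (addrC M).
Qed.

Lemma coefM_eq (p p' r r' : {poly K}) k :
  (forall i, (i <= k)%N -> p`_i = p'`_i) ->
  (forall i, (i <= k)%N -> r`_i = r'`_i) -> (p * r)`_k = (p' * r')`_k.
Proof.
move=> pp rr; rewrite !coefM; apply: eq_bigr => -[i /= ik] _.
by rewrite pp ?rr//; lia.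
Qed.

Lemma coef_ltrunc_lmul f g N1 N2 M i : lbd f N1 -> lbd g N2 -> (i < M)%N ->
  (ltrunc (lmul f g) (N1 + N2) M)`_i = (ltrunc f N1 M * ltrunc g N2 M)`_i.
Proof.
by move=> fN gM iM; rewrite -(lmul_trunc fN gM iM) coef_poly iM.
Qed.

Fact lmulA : associative lmul.
Proof.
move=> f g h; apply: laurent_eq => n.
have [N fN] := laurent_lbd f; have [M gM] := laurent_lbd g.
have [P hP] := laurent_lbd h.
have fgN := lmul_lbd fN gM; have ghN := lmul_lbd gM hP.
have [NMn|[k ->]] := lcoef_cases (N + (M + P)) n.
  by rewrite /= (@lmul_lbd f (lmul g h) _ _ fN ghN)// (@lmul_lbd (lmul f g) h _ _ fgN hP)// -addrA.
rewrite (@lmul_trunc f (lmul g h) _ _ _ _ fN ghN (ltnSn k)) addrA.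
rewrite [RHS](@lmul_trunc (lmul f g) h _ _ _ _ fgN hP (ltnSn k)).
rewrite (@coefM_eq _ (ltrunc f N k.+1) _ (ltrunc g M k.+1 * ltrunc h P k.+1))//;
  last by move=> i ik; rewrite coef_ltrunc_lmul.
by rewrite mulrA; apply: coefM_eq => // i ik; rewrite coef_ltrunc_lmul.
Qed.

Lemma lmono_lbd m c : lbd (lmono m c) m.
Proof. by move=> n /= mn; case: eqP => // nm; rewrite nm ltxx in mn. Qed.

Lemma lmonoM m c f n : lmul (lmono m c) f n = c * f (n - m).
Proof.
have [M fM] := laurent_lbd f; have mL := @lmono_lbd m c.
have [NMn|[k ->]] := lcoef_cases (m + M) n.
  by rewrite /= (lmul_lbd mL fM)// fM ?mulr0//; lia.
rewrite /= lmul_coefE// big_ord_recl big1 ?addr0/=.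
  by rewrite ifT; [congr (c * f _)|]; lia.
move=> i _; rewrite /bump /= ifF ?mul0r//; lia.
Qed.

Fact lmul1 : left_id (lmono 0 1) lmul.
Proof. by move=> f; apply: laurent_eq => n; rewrite lmonoM mul1r subr0. Qed.

Fact lmulDl : left_distributive lmul +%R.
Proof.
move=> f g h; apply: laurent_eq => n.
have [N fN] := laurent_lbd f; have [M gM] := laurent_lbd g.
have [P hP] := laurent_lbd h.
have fN' : lbd f (Num.max N M) by apply: lbdW fN; rewrite le_max lexx.
have gM' : lbd g (Num.max N M) by apply: lbdW gM; rewrite le_max lexx orbT.
have fgN : lbd (f + g) (Num.max N M).
  by move=> i Hi; rewrite /= fN'// gM'// addr0.
have [NMn|[k ->]] := lcoef_cases (Num.max N M + P) n.
  rewrite [LHS](lmul_lbd fgN hP)//=.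
  by rewrite (lmul_lbd fN' hP)// (lmul_lbd gM' hP)// addr0.
rewrite /= !lmul_coefE// -big_split; apply: eq_bigr => i _ /=.
by rewrite mulrDl.
Qed.

Fact lone_neq0 : lmono 0 1 != 0.
Proof.
apply/eqP => /(congr1 (fun f : laurent K => f 0)) /=.
by apply/eqP; rewrite oner_neq0.
Qed.

HB.instance Definition _ := GRing.Zmodule_isComNzRing.Build (laurent K)
  lmulA lmulC lmul1 lmulDl lone_neq0.

Fixpoint linv_seq (a : nat -> K) (k : nat) : seq K :=
  if k is k'.+1 then
    let s := linv_seq a k' in
    rcons s ((a 0%N)^-1 * ((k' == 0%N)%:R - \sum_(i < k') a i.+1 * s`_(k' - i.+1)))
  else [::].

Lemma size_linv_seq a k : size (linv_seq a k) = k.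
Proof. by elim: k => //= k IH; rewrite size_rcons IH. Qed.

Lemma nth_linv_seq a k j : (j < k)%N ->
  (linv_seq a k)`_j = (linv_seq a j.+1)`_j.
Proof.
elim: k => // k IH; rewrite ltnS leq_eqVlt => /predU1P[->//|jk].
by rewrite -(IH jk) [in LHS]/= nth_rcons size_linv_seq jk.
Qed.

Lemma linv_seqP a k : a 0%N != 0 ->
  \sum_(i < k.+1) a i * (linv_seq a (k - i).+1)`_(k - i) = (k == 0%N)%:R.
Proof.
move=> a0; rewrite big_ord_recl/= subn0 nth_rcons size_linv_seq ltnn eqxx.
rewrite mulrA divff// mul1r addrAC -addrA [X in _ + X](_ : _ = 0) ?addr0//.
apply/eqP; rewrite subr_eq0; apply/eqP; apply: eq_bigr => -[i /= ik] _.
by rewrite /bump /= add1n [in RHS](@nth_linv_seq a k)//; lia.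
Qed.

Lemma laurent_lead f : f != 0 -> exists2 N, f N != 0 & lbd f N.
Proof.
move=> f0; have [M fM] := laurent_lbd f.
have /existsNP[n /eqP fn] : ~ forall n, f n = 0.
  by move=> H; case/eqP: f0; apply: laurent_eq => n; rewrite H /= if_same.
have [Mn|[k nE]] := lcoef_cases M n; first by rewrite fM ?eqxx in fn.
have ex : exists k : nat, f (M - k%:Z) != 0 by exists k; rewrite -nE.
case: (ex_minnP ex) => m fm mmin; exists (M - m%:Z) => // i Hi.
have [|[j jE]] := lcoef_cases M i; first exact: fM.
apply/eqP; apply/negPn/negP; rewrite jE => /mmin; lia.
Qed.

Lemma linv_exists f : f != 0 -> exists g, g * f = 1.
Proof.
case/laurent_lead => N fN0 fN.
pose c j := (linv_seq (fun i : nat => f (N - i%:Z)) j.+1)`_j.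
have cP k : \sum_(i < k.+1) f (N - i%:Z) * c (k - i)%N = (k == 0%N)%:R.
  by apply: (@linv_seqP (fun i : nat => f (N - i%:Z))); rewrite subr0.
pose g0 (n : int) : K := if n <= - N then c `|- N - n|%N else 0.
have g0N : lbd g0 (- N) by move=> n Hn; rewrite /g0 ifF//; lia.
exists (mkL g0N); rewrite mulrC; apply: laurent_eq => n.
have [Hn|[k ->]] := lcoef_cases (N + - N) n.
  rewrite [LHS](lmul_lbd fN (g := mkL g0N) g0N)//= ifF//; lia.
rewrite [LHS](lmul_coefE k fN (g := mkL g0N) g0N)/=.
rewrite (eq_bigr (fun i : 'I_k.+1 => f (N - i%:Z) * c (k - i)%N)); last first.
  move=> -[i /= ik] _; rewrite /g0 ifT; last lia.
  by congr (_ * c _); lia.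
rewrite cP subrr sub0r oppr_eq0.
by case: k => [|k].
Qed.

Definition linv f : laurent K :=
  if pselect (exists g, g * f = 1) is left e then projT1 (cid e) else 0.

Fact lmulV f : f != 0 -> linv f * f = 1.
Proof.
move=> f0; rewrite /linv; case: pselect => [e|]; first exact: (projT2 (cid e)).
by move/linv_exists : f0.
Qed.

Fact linv0 : linv 0 = 0.
Proof.
rewrite /linv; case: pselect => // e; exfalso; case: e => g.
by rewrite mulr0 => /esym/eqP; rewrite oner_eq0.
Qed.

HB.instance Definition _ := GRing.ComNzRing_isField.Build (laurent K) lmulV linv0.

Definition lvar : laurent K := lmono 1 1.

(* degree in t, i.e. the opposite of the valuation (0 by convention at 0) *)
Definition ldeg f : int := xget 0 [set N : int | f N != 0 /\ lbd f N].

(* the valuation ring O = K[[t^-1]] *)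
Definition lint : set (laurent K) := [set f | lbd f 0].

Lemma lint1 : lint 1. Proof. exact: lmono_lbd. Qed.

Lemma lint0 : lint 0. Proof. by move=> n _ /=; rewrite if_same. Qed.

Lemma lintD f g : lint f -> lint g -> lint (f + g).
Proof. by move=> f0 g0 n n0 /=; rewrite f0// g0// addr0. Qed.

Lemma lintM f g : lint f -> lint g -> lint (f * g).
Proof. by move=> f0 g0; have := lmul_lbd f0 g0; rewrite addr0. Qed.

Lemma lpoly_subproof (p : {poly K}) :
  `[< bounded_above (fun n : int => if n is Posz k then p`_k else 0) >].
Proof.
apply/asboolP; exists (size p)%:Z => -[k|//] sk.
by rewrite nth_default// ltnW// -ltz_nat.
Qed.

(* K[t] as a subring of K((t^-1)) *)
Definition lpoly (p : {poly K}) : laurent K := Laurent (lpoly_subproof p).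

Lemma lpolyB : {morph lpoly : p r / p - r}.
Proof.
by move=> p r; apply: laurent_eq => -[k|k] /=; rewrite ?coefB ?subr0.
Qed.

Lemma lpoly1 : lpoly 1 = 1.
Proof.
by apply: laurent_eq => -[k|k] //=; rewrite coef1; case: k.
Qed.

Lemma lpolyM : {morph lpoly : p r / p * r}.
Proof.
move=> p r; apply: laurent_eq => -[k|k].
  rewrite [RHS]/= /lmul_coef.
  rewrite -(@fsbig_widen _ _ 0 +%R (Posz @` `I_k.+1))//.
    rewrite fsbig_image; last by move=> i j _ _ [].
    rewrite -(@fsbig_ord _ _ +%R k.+1
      (fun j : nat => lpoly p j%:Z * lpoly r (k%:Z - j%:Z))).
    rewrite [LHS]coefM; apply: eq_bigr => -[i /= ik] _; congr (_ * _).
    by rewrite (_ : k%:Z - i%:Z = (k - i)%N%:Z)//; lia.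
  move=> [i|i] [_ /= Hi]; last by rewrite mul0r.
  have ki : (k < i)%N.
    by rewrite ltnNge; apply/negP => ik; apply: Hi; exists i => //=; lia.
  have [j ->] : exists j, k%:Z - i%:Z = Negz j by exists (i - k).-1; lia.
  by rewrite mulr0.
apply/esym; apply: fsbig1 => -[i|i] _; last by rewrite mul0r.
have [j ->] : exists j, Negz k - i%:Z = Negz j by exists (k + i)%N; lia.
by rewrite mulr0.
Qed.

HB.instance Definition _ := GRing.isZmodMorphism.Build _ _ lpoly lpolyB.
HB.instance Definition _ :=
  GRing.isMonoidMorphism.Build _ _ lpoly (conj lpoly1 lpolyM).

End LaurentField.

Section Building.
Variable K : fieldType.
Local Notation F := (laurent K).
Local Notation t := (lvar K).

(* Elements of PGL(3, F) are given by representatives in GL(3, F). *)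
Definition GL3 : Type := {g : 'M[F]_3 | g \in unitmx}.
HB.instance Definition _ := Choice.on GL3.
Definition mkGL3 (g : 'M[F]_3) (gu : g \in unitmx) : GL3 :=
  exist (fun g : 'M[F]_3 => g \in unitmx) g gu.

(* GL(3, O) *)
Definition W : set 'M[F]_3 := [set w | w \in unitmx /\
  forall i j, lint (w i j) /\ lint (invmx w i j)].

Lemma W1 : W 1%:M.
Proof.
split; first exact: unitmx1.
have H i j : lint ((1%:M : 'M[F]_3) i j).
  by rewrite mxE; case: eqP => _; [exact: lint1|exact: lint0].
by move=> i j; rewrite invmx1; split; apply: H.
Qed.

Lemma WV w : W w -> W (invmx w).
Proof.
by move=> [wu wO]; split; [rewrite unitmx_inv|move=> i j; rewrite invmxK; have [? ?] := wO i j].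
Qed.

Lemma invmxM3 (v w : 'M[F]_3) : v \in unitmx -> w \in unitmx ->
  invmx (v *m w) = invmx w *m invmx v.
Proof. exact: invrM. Qed.

Lemma WM v w : W v -> W w -> W (v *m w).
Proof.
move=> [vu vO] [wu wO]; split; first by rewrite unitmx_mul vu.
have sumO (u u' : 'M[F]_3) : (forall i j, lint (u i j)) ->
    (forall i j, lint (u' i j)) -> forall i j, lint ((u *m u') i j).
  move=> uO u'O i j; rewrite mxE; apply: big_ind.
  - exact: lint0.
  - exact: lintD.
  - by move=> k _; apply: lintM.
move=> i j; rewrite invmxM3//; split; apply: sumO => {}i {}j.
- by have [] := vO i j.
- by have [] := wO i j.
- by have [] := wO i j.
- by have [] := vO i j.
Qed.

(* g PGL(3, O) = h PGL(3, O) in PGL(3, F) *)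
Definition vertex_rel : rel GL3 := fun g h =>
  `[< exists c : F, exists w, [/\ c != 0, W w & val h = c *: (val g *m w)] >].

Lemma vertex_refl : reflexive vertex_rel.
Proof.
move=> g; apply/asboolP; exists 1, 1%:M; split; first exact: oner_neq0.
- exact: W1.
- by rewrite mulmx1 scale1r.
Qed.

Lemma vertex_sym : symmetric vertex_rel.
Proof.
suff H g h : vertex_rel g h -> vertex_rel h g by move=> g h; apply/idP/idP; apply: H.
move=> /asboolP[c [w [c0 Ww hE]]]; apply/asboolP; exists c^-1, (invmx w).
split; [by rewrite invr_eq0|exact: WV|].
rewrite hE -scalemxAl scalerA mulVf// scale1r -mulmxA mulmxV ?mulmx1//.
by case: Ww.
Qed.

Lemma vertex_trans : transitive vertex_rel.
Proof.
move=> h g k /asboolP[c [w [c0 Ww hE]]] /asboolP[d [v [d0 Wv kE]]].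
apply/asboolP; exists (d * c), (w *m v); split; first by rewrite mulf_neq0.
- exact: WM.
- by rewrite kE hE -scalemxAl scalerA mulmxA.
Qed.

Canonical vertex_equiv := EquivRel vertex_rel vertex_refl vertex_sym vertex_trans.

(* the vertices PGL(3, F) / PGL(3, O) of the building *)
Definition vertex : Type := {eq_quot vertex_equiv}.
HB.instance Definition _ := Choice.on vertex.
HB.instance Definition _ : isEqQuotient GL3 vertex_rel vertex :=
  EqQuotient.on vertex.

Definition vtx (g : GL3) : vertex := \pi_vertex g.

(* the O-lattice g O^3 in F^3, and its homothets *)
Definition lattice (g : GL3) : set 'cV[F]_3 :=
  [set val g *m u | u in [set u : 'cV[F]_3 | forall i, lint (u i 0)]].

Definition homothety (c : F) (L : set 'cV[F]_3) : set 'cV[F]_3 :=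
  [set c *: u | u in L].

(* Adjacency in the building: for suitable representatives L of x and L' of y,
   one has t^-1 L < L' < L with strict inclusions. *)
Definition adjacent (x y : vertex) : Prop := exists c : F,
  [/\ c != 0,
      homothety t^-1 (lattice (repr x)) `<` homothety c (lattice (repr y)) &
      homothety c (lattice (repr y)) `<` lattice (repr x)].

(* the color of g PGL(3, O) is deg_t (det g) mod 3 *)
Definition color (x : vertex) : 'Z_3 := (ldeg (\det (val (repr x))))%:~R.

Definition Aplus (C : nmodType) (f : vertex -> C) (x : vertex) : C :=
  \sum_(y \in [set y | adjacent x y /\ color y = color x + 1]) f y.

(* GL(3, K[t]), acting on the vertices by left multiplication *)
Definition GL3poly : Type := {g : 'M[{poly K}]_3 | g \in unitmx}.
Definition mkGL3poly (g : 'M[{poly K}]_3) (gu : g \in unitmx) : GL3poly :=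
  exist (fun g : 'M[{poly K}]_3 => g \in unitmx) g gu.

Lemma gamma_subproof (g : GL3poly) (h : GL3) :
  map_mx (@lpoly K) (val g) *m val h \in unitmx.
Proof.
rewrite unitmx_mul (valP h) andbT unitmxE det_map_mx.
by apply: rmorph_unit; rewrite -unitmxE (valP g).
Qed.

Definition gamma_mul (g : GL3poly) (h : GL3) : GL3 :=
  mkGL3 (gamma_subproof g h).

Definition gamma_act (g : GL3poly) (x : vertex) : vertex :=
  vtx (gamma_mul g (repr x)).

Lemma gamma_actE (g : GL3poly) (h k : GL3) :
  val k = map_mx (@lpoly K) (val g) *m val h -> gamma_act g (vtx h) = vtx k.
Proof.
move=> kE; apply/eqmodP => /=.
have /asboolP[c [w [c0 Ww hE]]] : vertex_rel (repr (vtx h)) h.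
  by apply/eqmodP; rewrite reprK.
apply/asboolP; exists c, w; split => //=.
by rewrite kE hE -scalemxAr mulmxA.
Qed.

Lemma gamma_actP (g : GL3poly) (x : vertex) : exists2 k : GL3,
  val k = map_mx (@lpoly K) (val g) *m val (repr x) & gamma_act g x = vtx k.
Proof. by exists (gamma_mul g (repr x)). Qed.

Definition orbit_rel : rel vertex := fun x y =>
  `[< exists g : GL3poly, y = gamma_act g x >].

Lemma orbit_refl : reflexive orbit_rel.
Proof.
move=> x; apply/asboolP; exists (mkGL3poly (unitmx1 {poly K} 3)).
rewrite -[in RHS](reprK x) (@gamma_actE _ _ (repr x)) ?[vtx _]reprK//.
by rewrite map_mx1 mul1mx.
Qed.

Lemma orbit_sym : symmetric orbit_rel.
Proof.
suff H x y : orbit_rel x y -> orbit_rel y x by move=> x y; apply/idP/idP; apply: H.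
move=> /asboolP[g ->]; apply/asboolP; have [k kE ->] := gamma_actP g x.
have gV : invmx (val g) \in unitmx by rewrite unitmx_inv (valP g).
exists (mkGL3poly gV); rewrite (@gamma_actE _ _ (repr x)) ?[vtx _]reprK//.
by rewrite kE mulmxA -map_mxM mulVmx ?map_mx1 ?mul1mx//; exact: (valP g).
Qed.

Lemma orbit_trans : transitive orbit_rel.
Proof.
move=> y x z /asboolP[g ->] /asboolP[h ->]; apply/asboolP.
have [k kE ->] := gamma_actP g x.
have hg : val h *m val g \in unitmx by rewrite unitmx_mul (valP h) (valP g).
exists (mkGL3poly hg).
have [l lE ->] := gamma_actP (mkGL3poly hg) x.
by apply: gamma_actE; rewrite lE kE /= map_mxM mulmxA.
Qed.

Canonical orbit_equiv := EquivRel orbit_rel orbit_refl orbit_sym orbit_trans.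

(* the vertices of PGL(3, K[t]) \ B(G) *)
Definition orbit : Type := {eq_quot orbit_equiv}.
HB.instance Definition _ := Choice.on orbit.
HB.instance Definition _ : isEqQuotient vertex orbit_rel orbit :=
  EqQuotient.on orbit.

Definition orb (x : vertex) : orbit := \pi_orbit x.

Lemma xmn_subproof (m n : nat) :
  (diag_mx (\row_(j < 3) t ^+ nth 0%N [:: m; n; 0%N] j)) \in unitmx.
Proof.
rewrite unitmxE det_diag unitfE; apply/prodf_neq0 => i _; rewrite mxE.
apply: expf_neq0; apply/eqP => /(congr1 (fun f : F => f 1)) /=.
by apply/eqP; rewrite oner_neq0.
Qed.

Definition xmn (m n : nat) : GL3 := mkGL3 (xmn_subproof m n).

Definition vmn (m n : nat) : orbit := orb (vtx (xmn m n)).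

(* Functions on the quotient are the functions on the vertices that are
   invariant under PGL(3, K[t]); Aplus preserves these functions, so that the
   choice of the representative repr X is immaterial. *)
Definition Aw_plus (C : nmodType) (f : orbit -> C) (X : orbit) : C :=
  Aplus (f \o orb) (repr X).

End Building.

Section HilbertSpace.
Variables (R : realType) (K : finFieldType).
Local Notation C := R[i].
Local Notation q := (#|K|%:R : R).

Definition weight (m n : nat) : R :=
  if m == 0%N then (q ^+ 2 + q + 1)^-1
  else if (n == 0%N) || (n == m) then (q ^+ (2 * m))^-1
  else (q + 1) / q ^+ (2 * m).

Definition sqnorm (f : orbit K -> C) : \bar R :=
  \esum_(p in [set p : nat * nat | (p.2 <= p.1)%N])
    (ComplexField.Normc.normc (f (vmn K p.1 p.2)) ^+ 2 * weight p.1 p.2)%:E.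

Definition L2w : set (orbit K -> C) := [set f | (sqnorm f < +oo)%E].

(* the norm of f in L2w; meaningful only when sqnorm f is finite *)
Definition L2norm (f : orbit K -> C) : R := Num.sqrt (fine (sqnorm f)).

Definition bounded_operator (B : (orbit K -> C) -> (orbit K -> C)) : Prop :=
  [/\ forall f, L2w f -> L2w (B f),
      forall (a : C) f g, L2w f -> L2w g ->
        B (fun X => a * f X + g X) = (fun X => a * B f X + B g X) &
      exists M : R, forall f, L2w f -> L2norm (B f) <= M * L2norm f].

(* Operators on L2w are given by maps on all functions, of which only the
   restriction to L2w is relevant; lambda is in the spectrum of A when
   A - lambda has no two-sided inverse among the bounded operators on L2w. *)
Definition spectrum (A : (orbit K -> C) -> (orbit K -> C)) : set C :=
  [set lambda | ~ exists2 B, bounded_operator B &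
     forall f, L2w f ->
       B (fun X => A f X - lambda * f X) = f /\
       (fun X => A (B f) X - lambda * B f X) = f].

End HilbertSpace.

Section SpectralSets.
Variable R : realType.
Local Notation C := R[i].

(* exp (i theta) *)
Definition cis (theta : R) : C := (cos theta +i* sin theta)%C.

Definition Sigma0 (q : R) : set C :=
  let c := (q ^+ 2 + q + 1)%:C%C in
  [set z | [\/ z = c, z = c * cis (2 * trigo.pi / 3)
             | z = c * cis (4 * trigo.pi / 3)]].

Definition Sigma1 (q : R) : set C := [set z | exists theta : R,
  z = (q `^ (3 / 2))%:C%C * cis theta + q%:C%C * cis (- 2 * theta)
      + (q `^ (1 / 2))%:C%C * cis theta].

Definition Sigma2 (q : R) : set C := [set z | exists s1 s2 s3 : C,
  [/\ s1 * s2 * s3 = 1, `|s1| = 1, `|s2| = 1, `|s3| = 1 &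
      z = q%:C%C * (s1 + s2 + s3)]].

End SpectralSets.

(* Main.v *)
Require Import Defs.
From mathcomp Require Import all_boot all_order all_algebra.
From mathcomp Require Import perm zify ring lra.
From mathcomp Require Import all_classical all_reals all_analysis.
From mathcomp Require Import generic_quotient complex.

(* The neighbours of the vertex g W whose color is one more than its own are the
   g k_l D_l W, where l runs through the lines of K^3, k_l is unitriangular and
   D_l is diagonal.  For g = x_{m,n} the matrices k_l can be moved to the left of
   x_{m,n}, where they become polynomial, so only the pivot of l matters for the
   orbit; this gives the explicit formula for A_w^+ at v_{m,n}.  The v_{m,n}
   are pairwise distinct, because a nonzero term of the expansion of det gamma
   forces the exponents to agree, so functions of (m, n) are functions on the
   quotient.

   The functions w^(m + n) with w^3 = 1 are square integrable eigenfunctions, for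
   the points of Sigma0.  When s1 s2 s3 = 1, the function q^m s1^m s2^n satisfies
   the eigenvalue equation for q (s1 + s2 + s3) away from the walls n = 0 and
   n = m, and on the wall n = 0 as well if s3 = q s2.  Cutting it off by a tent of
   width N gives approximate eigenvectors: far from the walls when |s_i| = 1
   (Sigma2), and along the wall n = 0 when |s1| = 1, |s2| = q^(-1/2) and
   |s3| = q^(1/2) (Sigma1). *)

Set Implicit Arguments.
Unset Strict Implicit.
Unset Printing Implicit Defensive.

Import Order.TTheory GRing.Theory Num.Theory.
Import ComplexField.Normc.

Local Open Scope classical_set_scope.
Local Open Scope ring_scope.

(** * Degrees of Laurent series and integral matrices *)

Section LaurentDegree.
Variable K : fieldType.
Implicit Types f g : laurent K.

Lemma ldegP f : f != 0 -> f (ldeg f) != 0 /\ lbd f (ldeg f).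
Proof.
move=> /laurent_lead[N fN0 fN]; rewrite /ldeg.
by case: xgetP => [x -> //|/(_ N)]; case.
Qed.

Lemma lcoef0 n : (0 : laurent K) n = 0.
Proof. by rewrite /= if_same. Qed.

Lemma lcoef_neq0 f n : f n != 0 -> f != 0.
Proof. by apply: contra_neq => ->; rewrite lcoef0. Qed.

Lemma ldeg_lbd f N : f != 0 -> lbd f N -> ldeg f <= N.
Proof.
by move=> /ldegP[f0 _] fN; rewrite leNgt; apply: contra_neqN f0 => /fN.
Qed.

Lemma ldeg_eq f N : f N != 0 -> lbd f N -> ldeg f = N.
Proof.
move=> fN0 fN; have f0 := lcoef_neq0 fN0; apply/le_anti.
rewrite ldeg_lbd//= leNgt; apply: contra_neqN fN0.
by have [_] := ldegP f0; apply.
Qed.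

Lemma lmul_lead f g N M : lbd f N -> lbd g M -> (f * g) (N + M) = f N * g M.
Proof.
move=> fN gM; have := lmul_coefE 0 fN gM; rewrite subr0 => H.
by rewrite [LHS]H big_ord1 !subr0.
Qed.

Lemma ldegM f g : f != 0 -> g != 0 -> ldeg (f * g) = ldeg f + ldeg g.
Proof.
move=> /ldegP[f0 fN] /ldegP[g0 gN]; apply: ldeg_eq.
  by rewrite lmul_lead// mulf_neq0.
exact: lmul_lbd.
Qed.

Lemma lmonoE m (c : K) n : lmono m c n = if n == m then c else 0.
Proof. by []. Qed.

Lemma ldeg_mono m (c : K) : c != 0 -> ldeg (lmono m c) = m.
Proof. by move=> c0; apply: ldeg_eq; [rewrite lmonoE eqxx|exact: lmono_lbd]. Qed.

Lemma lmono_neq0 m (c : K) : c != 0 -> lmono m c != 0.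
Proof. by move=> c0; apply: (@lcoef_neq0 _ m); rewrite lmonoE eqxx. Qed.

Lemma ldeg1 : ldeg (1 : laurent K) = 0.
Proof. exact/ldeg_mono/oner_neq0. Qed.

Lemma ldegV f : f != 0 -> ldeg f^-1 = - ldeg f.
Proof.
move=> f0; have := ldegM f0 (invr_neq0 f0); rewrite divff// ldeg1; lia.
Qed.

Lemma lint_ldeg f : f != 0 -> lint f <-> ldeg f <= 0.
Proof.
move=> f0; split; first exact: ldeg_lbd.
by move=> f_le0; have [_] := ldegP f0; apply: lbdW.
Qed.

Lemma lmono_mul m n (c d : K) : lmono m c * lmono n d = lmono (m + n) (c * d).
Proof.
apply: laurent_eq => i; rewrite [LHS]lmonoM /=.
rewrite (_ : (i - m == n) = (i == m + n)); last by lia.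
by case: ifP; rewrite ?mulr0.
Qed.

Lemma lmonoD m (c d : K) : lmono m c + lmono m d = lmono m (c + d).
Proof. by apply: laurent_eq => i /=; case: ifP; rewrite ?addr0. Qed.

Lemma lmonoN m (c : K) : - lmono m c = lmono m (- c).
Proof. by apply: laurent_eq => i /=; case: ifP; rewrite ?oppr0. Qed.

Lemma lmono00 m : lmono m (0 : K) = 0.
Proof. by apply: laurent_eq => i /=; rewrite !if_same. Qed.

Lemma lvarX n : lvar K ^+ n = lmono n%:Z 1.
Proof.
elim: n => [//|n IHn]; rewrite exprS IHn lmono_mul mul1r; congr lmono; lia.
Qed.

Lemma lvarV : (lvar K)^-1 = lmono (- 1) 1.
Proof.
have t0 : lvar K != 0 by apply: lmono_neq0; exact: oner_neq0.
by apply: (mulfI t0); rewrite divff// lmono_mul mul1r subrr.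
Qed.

Lemma lintN f : lint f -> lint (- f).
Proof. by move=> f0 n n0 /=; rewrite f0// oppr0. Qed.

Lemma lint_mono m (c : K) : m <= 0 -> lint (lmono m c).
Proof. by move=> m0; apply: lbdW m0 _; exact: lmono_lbd. Qed.

Lemma residueM f g : lint f -> lint g -> (f * g) 0 = f 0 * g 0.
Proof. by move=> f0 g0; have := lmul_lead f0 g0; rewrite addr0. Qed.

(** Multiplication by [t] raises every degree by one, so the constant coefficient is what crosses
    the boundary of integrality. This turns divisibility conditions on lattices into linear
    conditions on residues. *)
Lemma lint_residue0 f : lint (lmono 1 1 * f) <-> lint f /\ f 0 = 0.
Proof.
have E n : (lmono 1 1 * f) n = f (n - 1) by rewrite [LHS]lmonoM mul1r.
split=> [H|[f0 f00] n n0].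
  have f1 n : -1 < n -> f n = 0.
    by move=> n1; have := H (n + 1); rewrite E addrK; apply; lia.
  by split; [move=> n n0|]; apply: f1 => //; lia.
rewrite E; have [->|n1] := eqVneq n 1; first by rewrite subrr.
by apply: f0; lia.
Qed.

Lemma lpolyX_mono (c : K) n : lpoly (c *: 'X^n) = lmono n%:Z c.
Proof.
apply: laurent_eq => -[k|k] //=; rewrite coefZ coefXn eqz_nat.
by case: ifP; rewrite ?mulr1 ?mulr0.
Qed.

(** A polynomial has no coefficients in negative degree; this discreteness is what later separates
    the orbits of the group over [K[t]]. *)
Lemma lpoly_lbd_ge0 (p : {poly K}) N : p != 0 -> lbd (lpoly p) N -> 0 <= N.
Proof.
move=> p0 pN; rewrite leNgt; apply/negP => N0; case/eqP: p0.
apply/polyP => k; rewrite coef0; have := pN k%:Z; apply; lia.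
Qed.

Lemma lpoly_unit_ldeg (p : {poly K}) : p \is a GRing.unit -> ldeg (lpoly p) = 0.
Proof.
rewrite poly_unitE => /andP[/size_poly1P[c c0 ->]] _.
by rewrite -[c%:P]mulr1 mul_polyC -(expr0 'X) lpolyX_mono ldeg_mono.
Qed.

End LaurentDegree.

Section IntegralMatrices.
Variable K : fieldType.
Local Notation F := (laurent K).

Definition mxint n (A : 'M[F]_n) := forall i j, lint (A i j).

Lemma lint_sum (I : Type) (r : seq I) (P : pred I) (f : I -> F) :
  (forall i, P i -> lint (f i)) -> lint (\sum_(i <- r | P i) f i).
Proof. by move=> fi; apply: big_ind => //; [exact: lint0|exact: lintD]. Qed.

Lemma mxintM n (A B : 'M[F]_n) : mxint A -> mxint B -> mxint (A *m B).
Proof. by move=> Ai Bi i j; rewrite mxE; apply: lint_sum => k _; apply: lintM. Qed.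

Lemma lint_sign k : lint ((-1) ^+ k : F).
Proof.
elim: k => [|k IHk]; first exact: lint1.
by rewrite exprS mulN1r; apply: lintN.
Qed.

Lemma lint_det n (A : 'M[F]_n) : mxint A -> lint (\det A).
Proof.
move=> Ai; rewrite /determinant; apply: lint_sum => s _; apply: lintM (lint_sign _) _.
by apply: big_ind => //; [exact: lint1|exact: lintM].
Qed.

Lemma mxint_adj n (A : 'M[F]_n) : mxint A -> mxint (\adj A).
Proof.
move=> Ai i j; rewrite mxE /cofactor; apply: lintM (lint_sign _) _.
by apply: lint_det => k l; rewrite !mxE.
Qed.

Lemma invmx_adj n (A : 'M[F]_n) : A \in unitmx -> invmx A = (\det A)^-1 *: \adj A.
Proof. by rewrite /invmx => ->. Qed.

Lemma unitmx_neq0 n (A : 'M[F]_n) : (A \in unitmx) = (\det A != 0).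
Proof. by rewrite unitmxE unitfE. Qed.

(** By Cramer's rule the inverse is the inverse determinant, of degree 0, times the integral
    adjugate. *)
Lemma W_mxint (w : 'M[F]_3) : mxint w -> \det w != 0 -> ldeg (\det w) = 0 -> W w.
Proof.
move=> wi w0 wd; have wu : w \in unitmx by rewrite unitmx_neq0.
split=> // i j; split=> //; rewrite invmx_adj// mxE; apply: lintM.
  by apply/lint_ldeg; rewrite ?invr_eq0// ldegV// wd oppr0.
exact: mxint_adj.
Qed.

Lemma W_int w : W w -> mxint (w : 'M[F]_3).
Proof. by move=> [_ H] i j; have [] := H i j. Qed.

Lemma W_unit w : W w -> (w : 'M[F]_3) \in unitmx.
Proof. by case. Qed.

Lemma W_ldeg w : W w -> ldeg (\det (w : 'M[F]_3)) = 0.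
Proof.
move=> Ww; have := W_unit Ww; rewrite unitmx_neq0 => w0.
have H : ldeg (\det (w : 'M[F]_3)) <= 0.
  by apply: (lint_ldeg w0).1; apply/lint_det/W_int.
have iw0 : \det (invmx w) != 0 by rewrite det_inv invr_eq0.
have : ldeg (\det (invmx w)) <= 0.
  by apply: (lint_ldeg iw0).1; apply/lint_det/W_int/WV.
by rewrite det_inv ldegV// oppr_le0 => H'; apply/le_anti/andP.
Qed.

End IntegralMatrices.

(** * Neighbours of a vertex *)

Section MatrixFrames.
Variables (F : fieldType) (n : nat).
Implicit Types (A B p w : 'M[F]_n) (c e : F).

Lemma invmxMn A B : A \in unitmx -> B \in unitmx ->
  invmx (A *m B) = invmx B *m invmx A.
Proof.
move=> Au Bu; have ABu : A *m B \in unitmx by rewrite unitmx_mul Au.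
have E : (A *m B) *m (invmx B *m invmx A) = 1%:M.
  by rewrite -mulmxA mulKVmx// mulmxV.
by rewrite -[LHS]mulmx1 -E mulKmx.
Qed.

Lemma invmxZn c A : c != 0 -> A \in unitmx -> invmx (c *: A) = c^-1 *: invmx A.
Proof. by move=> c0 Au; rewrite invmxZ// unitmxZ ?unitfE. Qed.

Lemma invmx_change c p q : c != 0 -> p \in unitmx -> q \in unitmx ->
  invmx (c *: (invmx p *m q)) = c^-1 *: (invmx q *m p).
Proof.
move=> c0 pu qu; rewrite invmxZn ?unitmx_mul ?unitmx_inv ?pu//.
by rewrite invmxMn ?unitmx_inv// invmxK.
Qed.

(* In the frames [p = e g w] and [p' = e' (g N) w'], the matrix [N] becomes
   [w^-1 N w'] up to a scalar. *)
Lemma change_frame e e' (g N w w' : 'M[F]_n) : e != 0 -> e' != 0 ->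
  g \in unitmx -> w \in unitmx ->
  (e / e') *: (invmx (e *: (g *m w)) *m (e' *: (g *m N *m w'))) =
  invmx w *m N *m w'.
Proof.
move=> e0 e0' gu wu; rewrite invmxZn ?unitmx_mul ?gu// invmxMn//.
rewrite -scalemxAl -scalemxAr !scalerA (_ : _ * _ * _ = 1); last first.
  by field; rewrite e0 e0'.
by rewrite scale1r -!mulmxA mulKmx.
Qed.

(** Passing from the frame [p] to the frame [g] multiplies the transition matrix by [w] on the left,
    up to a scalar on [q]. *)
Lemma change_frameV c e (g p w q : 'M[F]_n) : e != 0 ->
  p \in unitmx -> p = e *: (g *m w) ->
  g *m (w *m (c *: (invmx p *m q))) = (c / e) *: q.
Proof.
move=> e0 pu pE; rewrite mulmxA (_ : g *m w = e^-1 *: p).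
  by rewrite -scalemxAl -scalemxAr mulKVmx// scalerA mulrC.
by rewrite pE scalerA mulVf// scale1r.
Qed.

Lemma scaled_mulmx_solve c d (p q : 'M[F]_n) (u v : 'cV[F]_n) : d != 0 ->
  q \in unitmx -> d *: (q *m v) = c *: (p *m u) ->
  v = ((c / d) *: (invmx q *m p)) *m u.
Proof.
move=> d0 qu E; rewrite -scalemxAl -mulmxA mulrC -scalerA scalemxAr -E.
by rewrite -scalemxAr mulKmx// scalerA mulVf ?scale1r.
Qed.

Lemma scaled_mulmx_solveK c d (p q : 'M[F]_n) (u : 'cV[F]_n) : d != 0 ->
  q \in unitmx ->
  d *: (q *m (((c / d) *: (invmx q *m p)) *m u)) = c *: (p *m u).
Proof.
move=> d0 qu; rewrite -scalemxAl -mulmxA -scalemxAr mulKVmx// scalerA.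
by rewrite mulrC -mulrA mulVf ?mulr1.
Qed.

End MatrixFrames.

(** * Adjacency and colour as conditions on a transition matrix *)

Section Neighbours.
Variable K : fieldType.
Local Notation F := (laurent K).
Local Notation t := (lvar K).
Local Notation vertex := (vertex K).
Implicit Types (g h : GL3 K) (x y : vertex).

(** A lattice is spanned by the columns of its matrix, so an inclusion only has to be tested on the
    images of the standard basis vectors. *)
Lemma homothety_sub (c d : F) g h : d != 0 ->
  homothety c (lattice g) `<=` homothety d (lattice h) <->
  mxint ((c / d) *: (invmx (val h) *m val g)).
Proof.
move=> d0; have hu : val h \in unitmx := valP h.
split=> [H i j|H _ [_ [u ui <-] <-]].
  have /H[_ [v vi <-] E] : homothety c (lattice g) (c *: (val g *m delta_mx j 0)).
    exists (val g *m delta_mx j 0) => //; exists (delta_mx j 0) => // k /=.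
    by rewrite mxE andbT; case: eqP => _; [exact: lint1|exact: lint0].
  have := vi i; rewrite (scaled_mulmx_solve d0 hu E) -colE mxE; exact.
exists (val h *m (((c / d) *: (invmx (val h) *m val g)) *m u)); last first.
  exact: scaled_mulmx_solveK.
exists (((c / d) *: (invmx (val h) *m val g)) *m u); last exact: erefl.
by move=> i /=; rewrite mxE; apply: lint_sum => k _; apply: lintM.
Qed.

Lemma vtx_eqP g h : vtx g = vtx h <->
  exists c : F, exists w, [/\ c != 0, W w & val h = c *: (val g *m w)].
Proof.
split=> [gh|H]; last by apply/eqmodP/asboolP.
by have /asboolP : vertex_rel g h by apply/eqmodP.
Qed.

Lemma repr_vtxP g :
  exists c : F, exists w, [/\ c != 0, W w & val (repr (vtx g)) = c *: (val g *m w)].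
Proof. by apply/vtx_eqP; rewrite [vtx (repr _)]reprK. Qed.

(** With [Q] the transition matrix from [x] to [y], the first two conditions are the two inclusions
    and the last two say that neither inclusion can be reversed. *)
Lemma adjacentE x y : Defs.adjacent x y <-> exists2 c : F, c != 0 &
  let Q := c *: (invmx (val (repr x)) *m val (repr y)) in
  [/\ mxint Q, mxint (t^-1 *: invmx Q),
      ~ mxint (t *: Q) & ~ mxint (invmx Q)].
Proof.
have pu : val (repr x) \in unitmx := valP (repr x).
have pu' : val (repr y) \in unitmx := valP (repr y).
have homo1 g : lattice g = homothety 1 (lattice g).
  apply/seteqP; split=> [u ug|_ [u ug <-]]; last by rewrite scale1r.
  by exists u; [exact: ug|rewrite scale1r].
have t0 : t != 0 by apply: lmono_neq0; exact: oner_neq0.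
have tV0 : t^-1 != 0 by rewrite invr_eq0.
rewrite /Defs.adjacent.
split=> [[c [c0 [A B] [D E]]]|[c c0 [A B D E]]]; exists c.
- exact: c0.
- rewrite (homo1 (repr x)) in D E.
  move/homothety_sub : A => /(_ c0) A.
  move/homothety_sub : D => /(_ (oner_neq0 _)); rewrite divr1 => D.
  rewrite /= (invmx_change c0 pu pu'); split; [exact: D|..].
  + by rewrite scalerA; exact: A.
  + move=> H; apply: B; apply/homothety_sub; first exact: tV0.
    by rewrite invrK mulrC -scalerA; exact: H.
  + move=> H; apply: E; apply/homothety_sub; first exact: c0.
    by rewrite mul1r; exact: H.
- rewrite (invmx_change c0 pu pu') in B E; rewrite scalerA in B; split; first exact: c0.
    split; first by apply/homothety_sub; [exact: c0|exact: B].
    move/homothety_sub => /(_ tV0); rewrite invrK mulrC -scalerA; exact: D.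
  rewrite (homo1 (repr x)); split.
    by apply/homothety_sub; [exact: oner_neq0|rewrite divr1; exact: A].
  move/homothety_sub => /(_ c0); rewrite mul1r; exact: E.
Qed.

Lemma ldegX (f : F) n : f != 0 -> ldeg (f ^+ n) = ldeg f *+ n.
Proof.
move=> f0; elim: n => [|n IHn]; first exact: ldeg1.
by rewrite exprS ldegM ?expf_neq0// IHn mulrS.
Qed.

Lemma ldeg_detZ (c : F) (A : 'M[F]_3) : c != 0 -> \det A != 0 ->
  ldeg (\det (c *: A)) = 3 * ldeg c + ldeg (\det A).
Proof. by move=> c0 A0; rewrite detZ ldegM ?expf_neq0// ldegX// mulr_natl. Qed.

Lemma ldeg_detM (A B : 'M[F]_3) : \det A != 0 -> \det B != 0 ->
  ldeg (\det (A *m B)) = ldeg (\det A) + ldeg (\det B).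
Proof. by move=> A0 B0; rewrite det_mulmx ldegM. Qed.

Lemma mxint_ldeg_det (A : 'M[F]_3) : \det A != 0 -> mxint A -> ldeg (\det A) <= 0.
Proof. by move=> A0 Ai; apply: (lint_ldeg A0).1; apply: lint_det. Qed.

Lemma Z3_1 (d : int) : - 3 <= d <= 0 -> d%:~R = 1 :> 'Z_3 -> d = - 2.
Proof.
move=> /andP[d1 d2]; have : [\/ d = 0, d = - 1, d = - 2 | d = - 3].
  have [->|[->|[->|->]]] : d = 0 \/ d = -1 \/ d = -2 \/ d = -3 by lia.
  - exact: Or41. - exact: Or42. - exact: Or43. - exact: Or44.
by case=> -> //= /(congr1 val).
Qed.

Lemma ldeg_det_repr g : (ldeg (\det (val (repr (vtx g)))))%:~R =
  (ldeg (\det (val g)))%:~R :> 'Z_3.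
Proof.
have gu := valP g.
have [c [w [c0 Ww ->]]] := repr_vtxP g; have wu := W_unit Ww.
rewrite ldeg_detZ//; last by rewrite -unitmx_neq0 unitmx_mul gu.
rewrite ldeg_detM -?unitmx_neq0// (W_ldeg Ww) addr0 rmorphD/= rmorphM/=.
by rewrite (_ : 3%:~R = 0 :> 'Z_3) ?mul0r ?add0r//; apply/val_inj.
Qed.

(** The determinants of [N] and of [t^-1 N^-1] are both integral, and the latter has degree
    [-3 - ldeg (\det N)]. *)
Lemma mxint_ldeg_det_bounds (N : 'M[F]_3) : N \in unitmx -> mxint N ->
  mxint (t^-1 *: invmx N) -> - 3 <= ldeg (\det N) <= 0.
Proof.
rewrite unitmx_neq0 => N0 Ni Nti; apply/andP; split; last exact: mxint_ldeg_det.
have t0 : t != 0 by apply: lmono_neq0; exact: oner_neq0.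
have iN0 : \det (invmx N) != 0 by rewrite det_inv invr_eq0.
have tN0 : \det (t^-1 *: invmx N) != 0.
  by rewrite detZ mulf_neq0// expf_neq0// invr_eq0.
have := mxint_ldeg_det tN0 Nti; rewrite ldeg_detZ ?invr_eq0//.
rewrite det_inv !ldegV// ldeg_mono ?oner_neq0//.
by rewrite mulrN1 subr_le0.
Qed.

Lemma color_frame g y c (N : 'M[F]_3) : c != 0 -> N \in unitmx ->
  val g *m N = c *: val (repr y) ->
  color y = color (vtx g) + (ldeg (\det N))%:~R.
Proof.
move=> c0 Nu E; have gu : val g \in unitmx := valP g.
have yu : val (repr y) \in unitmx := valP (repr y).
rewrite /color ldeg_det_repr.
have := congr1 (fun A : 'M[F]_3 => ldeg (\det A)) E.
rewrite /= ldeg_detM -?unitmx_neq0// ldeg_detZ -?unitmx_neq0//.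
move=> /(congr1 (fun d : int => d%:~R : 'Z_(3))).
rewrite !rmorphD/= rmorphM/= => ->.
by rewrite (_ : 3%:~R = 0 :> 'Z_3) ?mul0r ?add0r//; apply/val_inj.
Qed.

(** The degree of [\det N] lies between -3 and 0 and is 1 modulo 3 by the colour condition, hence
    equals -2. The representative chosen by [repr] differs from [g] by a scalar and an element of
    [W], which changes none of the conditions. *)
Lemma neighbourP g y :
  Defs.adjacent (vtx g) y /\ color y = color (vtx g) + 1 <->
  exists N, exists h, [/\ N \in unitmx, mxint N, mxint (t^-1 *: invmx N),
    ldeg (\det N) = - 2 & val h = val g *m N /\ y = vtx h].
Proof.
have gu : val g \in unitmx := valP g.
have t0 : t != 0 by apply: lmono_neq0; exact: oner_neq0.
have t1 : ldeg t = 1 by apply: ldeg_mono; exact: oner_neq0.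
have [e [w [e0 Ww pE]]] := repr_vtxP g; have wu := W_unit Ww.
have iwu : invmx w \in unitmx by rewrite unitmx_inv.
have pu : val (repr (vtx g)) \in unitmx := valP (repr (vtx g)).
split=> [[/adjacentE[c c0]]|[N [h [Nu Ni Nti dN [hE ->]]]]].
  have pu' : val (repr y) \in unitmx := valP (repr y).
  have gN := @change_frameV F 3 c e (val g) _ w (val (repr y)) e0 pu pE.
  have Qu : c *: (invmx (val (repr (vtx g))) *m val (repr y)) \in unitmx.
    by rewrite unitmxZ ?unitfE// unitmx_mul unitmx_inv pu.
  move: Qu gN; move: (c *: _) => Q Qu gN /= [Qi Qti _ _] col.
  have Nu : w *m Q \in unitmx by rewrite unitmx_mul wu.
  have Ni : mxint (w *m Q) := mxintM (W_int Ww) Qi.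
  have Nti : mxint (t^-1 *: invmx (w *m Q)).
    rewrite (invmxMn wu Qu) scalemxAl.
    exact: mxintM Qti (W_int (WV Ww)).
  have hu : val g *m (w *m Q) \in unitmx by rewrite unitmx_mul gu.
  have ce0 : c / e != 0 by rewrite mulf_neq0// invr_eq0.
  exists (w *m Q), (mkGL3 hu); split; [exact: Nu|exact: Ni|exact: Nti| |].
    apply: Z3_1 (mxint_ldeg_det_bounds Nu Ni Nti) _.
    apply: (addrI (color (vtx g))); rewrite -col; apply/esym.
    exact: color_frame ce0 Nu gN.
  split; first exact: erefl.
  rewrite -[LHS]reprK; apply/vtx_eqP; exists (c / e), 1%:M.
  split; [exact: ce0|exact: W1|].
  by rewrite mulmx1 -gN.
have [e' [w' [e0' Ww' pE']]] := repr_vtxP h; have wu' := W_unit Ww'.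
have Nu' : N *m w' \in unitmx by rewrite unitmx_mul Nu.
split; last first.
  rewrite (@color_frame g _ e'^-1 (N *m w')).
  - rewrite ldeg_detM -?unitmx_neq0// dN (W_ldeg Ww') addr0; congr (_ + _).
    exact/val_inj.
  - by rewrite invr_eq0.
  - exact: Nu'.
  - by rewrite pE' hE scalerA mulVf// scale1r mulmxA.
apply/adjacentE; exists (e / e'); first by rewrite mulf_neq0// invr_eq0.
rewrite pE pE' hE (change_frame _ _ e0 e0' gu wu).
have iNw : invmx (invmx w *m N *m w') = invmx w' *m invmx N *m w.
  by rewrite invmxMn ?unitmx_mul ?iwu// invmxMn// invmxK mulmxA.
have Q0 : \det (invmx w *m N *m w') != 0 by rewrite -unitmx_neq0 !unitmx_mul iwu Nu.
have dQ : ldeg (\det (invmx w *m N *m w')) = - 2.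
  have wN0 : \det (invmx w *m N) != 0 by rewrite -unitmx_neq0 unitmx_mul iwu.
  have N0 : \det N != 0 by rewrite -unitmx_neq0.
  have w0 : \det (invmx w) != 0 by rewrite -unitmx_neq0.
  have w0' : \det w' != 0 by rewrite -unitmx_neq0.
  rewrite (ldeg_detM wN0 w0') (ldeg_detM w0 N0) (W_ldeg Ww') (W_ldeg (WV Ww)).
  by rewrite add0r addr0.
have Qi : mxint (invmx w *m N *m w').
  exact: mxintM (mxintM (W_int (WV Ww)) Ni) (W_int Ww').
have Qti : mxint (t^-1 *: invmx (invmx w *m N *m w')).
  rewrite iNw scalemxAl scalemxAr.
  exact: mxintM (mxintM (W_int (WV Ww')) Nti) (W_int Ww).
move: (invmx w *m N *m w') Qi Qti Q0 dQ => Q Qi Qti Q0 dQ.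
split; [exact: Qi|exact: Qti| |].
(* Strictness follows from the degree -2: the determinants of [t Q] and [Q^-1] have degrees 1 and 2,
   which no integral matrix allows. *)
- have tQ0 : \det (t *: Q) != 0 by rewrite detZ mulf_neq0 ?expf_neq0.
  by move=> /(mxint_ldeg_det tQ0); rewrite ldeg_detZ// dQ t1.
- have iQ0 : \det (invmx Q) != 0 by rewrite det_inv invr_eq0.
  by move=> /(mxint_ldeg_det iQ0); rewrite det_inv ldegV// dQ.
Qed.

End Neighbours.

(** * Unitriangular matrices and the adjugate in size 3 *)

Section Unitriangular.
Variable R : comNzRingType.
Implicit Types x y z : R.

Definition uni x y z : 'M[R]_3 := \matrix_(i < 3, j < 3)
  nth 0 (nth [::] [:: [:: 1; x; y]; [:: 0; 1; z]; [:: 0; 0; 1]] i) j.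

Lemma uni_mulE x y z (A : 'M[R]_3) (i j : 'I_3) : (uni x y z *m A) i j =
  nth 0 [:: A 0 j + x * A 1 j + y * A 2 j; A 1 j + z * A 2 j; A 2 j] i.
Proof.
rewrite !mxE !big_ord_recl big_ord0 !mxE /= addr0.
have -> : lift ord0 ord0 = 1 :> 'I_3 by apply/val_inj.
have -> : lift ord0 (lift ord0 ord0) = 2 :> 'I_3 by apply/val_inj.
case: i => -[|[|[|//]]] ? /=; first by rewrite mul1r addrA.
  by rewrite mul0r mul1r add0r.
by rewrite !mul0r mul1r !add0r.
Qed.

Lemma uniM x y z x' y' z' : uni x y z *m uni x' y' z' =
  uni (x + x') (y' + x * z' + y) (z + z').
Proof.
apply/matrixP => i j; rewrite uni_mulE !mxE.
by case: i => -[|[|[|//]]] ?; case: j => -[|[|[|//]]] ? /=; ring.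
Qed.

Lemma uni0 : uni 0 0 0 = 1%:M.
Proof.
apply/matrixP => i j; rewrite !mxE.
by case: i => -[|[|[|//]]] ?; case: j => -[|[|[|//]]].
Qed.

Lemma det_uni x y z : \det (uni x y z) = 1.
Proof.
rewrite -det_tr det_trig.
  by rewrite !big_ord_recl big_ord0 !mxE /= !mul1r.
apply/is_trig_mxP => i j; rewrite !mxE.
by case: i => -[|[|[|//]]] ?; case: j => -[|[|[|//]]].
Qed.

(* indices are taken modulo 3, which absorbs the signs of the cofactors *)
Lemma adj3E (A : 'M[R]_3) (i j : 'I_3) : \adj A j i =
  A (i + 1) (j + 1) * A (i + 2) (j + 2) - A (i + 1) (j + 2) * A (i + 2) (j + 1).
Proof.
rewrite mxE /cofactor (expand_det_row _ ord0) !big_ord_recl big_ord0 /cofactor.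
rewrite !det_mx11 !mxE.
pose B (k l : nat) := A (inord k) (inord l).
have AE k l : A k l = B k l by rewrite /B !inord_val.
rewrite !{}AE; move: B => B.
case: i => -[|[|[|//]]] ?; case: j => -[|[|[|//]]] ?; rewrite /= /bump /=;
  repeat match goal with
  | |- context [(?k %% 3)%N] =>
    let v := eval vm_compute in (k %% 3)%N in change (k %% 3)%N with v
  | |- context [B (?k + ?l)%N] =>
    let v := eval vm_compute in (k + l)%N in change (k + l)%N with v
  | |- context [B ?i (?k + ?l)%N] =>
    let v := eval vm_compute in (k + l)%N in change (k + l)%N with v
  end; ring.
Qed.

End Unitriangular.

(** * Lines of [K^3] and their lattices *)

Section Lines.
Variable K : fieldType.
Local Notation F := (laurent K).
Local Notation t := (lvar K).
Local Notation mono := (@lmono K).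

Definition dgm (a : nat -> int) : 'M[F]_3 := diag_mx (\row_(j < 3) mono (a j) 1).

Lemma dgm_mulE a (A : 'M[F]_3) i j : (dgm a *m A) i j = mono (a i) 1 * A i j.
Proof. by rewrite mul_diag_mx !mxE. Qed.

Lemma mul_dgmE a (A : 'M[F]_3) i j : (A *m dgm a) i j = A i j * mono (a j) 1.
Proof. by rewrite mul_mx_diag !mxE. Qed.

Lemma dgmM a b : dgm a *m dgm b = dgm (fun k => a k + b k).
Proof.
apply/matrixP => i j; rewrite dgm_mulE !mxE; case: eqP => _.
  by rewrite !mulr1n lmono_mul mulr1.
by rewrite !mulr0n mulr0.
Qed.

Lemma dgm0 a : (forall k, a k = 0) -> dgm a = 1%:M.
Proof. by move=> a0; apply/matrixP => i j; rewrite !mxE a0. Qed.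

Lemma det_dgm a : \det (dgm a) = mono (a 0%N + a 1%N + a 2%N) 1.
Proof.
rewrite det_diag !big_ord_recl big_ord0 !mxE mulr1 !lmono_mul !mulr1.
by congr lmono; rewrite addrA.
Qed.

Lemma det_dgm_neq0 a : \det (dgm a) != 0.
Proof. by rewrite det_dgm lmono_neq0// oner_neq0. Qed.

Lemma ldeg_dgm a : ldeg (\det (dgm a)) = a 0%N + a 1%N + a 2%N.
Proof. by rewrite det_dgm ldeg_mono// oner_neq0. Qed.

(* The lines of [K^3] are encoded by [unit + K + K * K]: their generators are
   [(1, 0, 0)], [(a, 1, 0)] and [(a, b, 1)]. *)
Definition pivot (T : Type) (l : unit + T + T * T) : nat :=
  match l with inl (inl _) => 0 | inl (inr _) => 1 | inr _ => 2 end.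

(** Exponents of the diagonal matrix [D_l]: the lattice [D_l O^3] consists of the integral vectors
    whose residue lies on the pivot axis. *)
Definition lexp (l : unit + K + K * K) (k : nat) : int :=
  if k == pivot l then 0 else - 1.

(** Entries of the unitriangular matrix whose column at the pivot is the generator of [l]; it
    carries the pivot axis to [l]. *)
Definition lcrd (l : unit + K + K * K) : K * K * K :=
  match l with
  | inl (inl _) => (0, 0, 0) | inl (inr a) => (a, 0, 0)
  | inr (a, b) => (0, a, b)
  end.

Definition cuni (x y z : K) : 'M[F]_3 := uni (mono 0 x) (mono 0 y) (mono 0 z).

Lemma cuniM x y z x' y' z' : cuni x y z *m cuni x' y' z' =
  cuni (x + x') (y' + x * z' + y) (z + z').
Proof. by rewrite /cuni uniM lmono_mul !lmonoD. Qed.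

Lemma cuniE x y z i j : cuni x y z i j = mono 0 (uni x y z i j).
Proof.
rewrite !mxE; case: i => -[|[|[|//]]] ?; case: j => -[|[|[|//]]] ? //=;
  by rewrite lmono00.
Qed.

Lemma cuni_int x y z : mxint (cuni x y z).
Proof. by move=> i j; rewrite cuniE; exact: lint_mono. Qed.

(* [line_mx l *m O^3] is the lattice of the integral vectors whose residue
   lies on the line [l]. *)
Definition line_mx l : 'M[F]_3 :=
  let: (x, y, z) := lcrd l in cuni x y z *m dgm (lexp l).

Definition line_mxV l : 'M[F]_3 :=
  let: (x, y, z) := lcrd l in
  dgm (fun k => - lexp l k) *m cuni (- x) (x * z - y) (- z).

Lemma line_mxK l : line_mx l *m line_mxV l = 1%:M.
Proof.
rewrite /line_mx /line_mxV; case: (lcrd l) => -[x y] z.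
rewrite -mulmxA [dgm _ *m (_ *m _)]mulmxA dgmM dgm0 => [|k]; last exact: subrr.
rewrite mul1mx cuniM; have := @uni0 F; rewrite -(lmono00 K 0) => <-.
by congr cuni; ring.
Qed.

Lemma line_mx_unit l : line_mx l \in unitmx.
Proof. exact: (mulmx1_unit (line_mxK l)).1. Qed.

Lemma invmx_line l : invmx (line_mx l) = line_mxV l.
Proof. by rewrite -[LHS]mulmx1 -(line_mxK l) mulKmx// line_mx_unit. Qed.

Lemma line_mx_int l : mxint (line_mx l).
Proof.
move=> i j; rewrite /line_mx; case: (lcrd l) => -[x y] z; rewrite mul_dgmE.
apply: lintM; first exact: cuni_int.
by apply: lint_mono; rewrite /lexp; case: eqP.
Qed.

Lemma line_mxV_int l : mxint (t^-1 *: invmx (line_mx l)).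
Proof.
rewrite invmx_line => i j; rewrite /line_mxV; case: (lcrd l) => -[x y] z.
rewrite mxE dgm_mulE mulrA (lvarV K) lmono_mul; apply: lintM; last exact: cuni_int.
by apply: lint_mono; rewrite /lexp; case: eqP.
Qed.

Lemma ldeg_line l : ldeg (\det (line_mx l)) = - 2.
Proof.
rewrite /line_mx; case: (lcrd l) => -[x y] z; rewrite det_mulmx.
by rewrite [\det (cuni _ _ _)]det_uni mul1r ldeg_dgm; case: l => [[?|?]|?].
Qed.

Lemma ldeg_lineV l : ldeg (\det (line_mxV l)) = 2.
Proof.
have l0 : \det (line_mx l) != 0 by rewrite -unitmx_neq0 line_mx_unit.
by rewrite -invmx_line det_inv ldegV// ldeg_line opprK.
Qed.

(** The residue of [N] has rank at most one. Indeed [t] times the adjugate is [t^2 \det N], of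
    degree 0, times the integral matrix [t^-1 N^-1], so the adjugate has zero residue. *)
Lemma residue_minors (N : 'M[F]_3) i j k : N \in unitmx -> mxint N ->
  mxint (t^-1 *: invmx N) -> ldeg (\det N) = - 2 ->
  N (i + 1) j 0 * N (i + 2) k 0 = N (i + 1) k 0 * N (i + 2) j 0.
Proof.
move=> Nu Ni Nti dN; have N0 : \det N != 0 by rewrite -unitmx_neq0.
have t0 : t != 0 by apply: lmono_neq0; exact: oner_neq0.
have t1 : ldeg t = 1 by apply: ldeg_mono; exact: oner_neq0.
have adjN l : (\adj N l i) 0 = 0.
  suff /lint_residue0[] : lint (t * \adj N l i) by [].
  have -> : \adj N l i = (t * \det N) * (t^-1 *: invmx N) l i.
    rewrite (invmx_adj Nu); move: (\adj N) => B.
    have -> : (t^-1 *: ((\det N)^-1 *: B)) l i = t^-1 * ((\det N)^-1 * B l i).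
      by rewrite 2!mxE.
    by rewrite mulrACA divff// mul1r mulVKf.
  rewrite mulrA; apply: lintM; last exact: Nti.
  have tN0 : t * \det N != 0 by rewrite mulf_neq0.
  have ttN0 : t * (t * \det N) != 0 by rewrite mulf_neq0.
  by apply/(lint_ldeg ttN0); rewrite ldegM// ldegM// dN t1.
have H l : N (i + 1) (l + 1) 0 * N (i + 2) (l + 2) 0 =
    N (i + 1) (l + 2) 0 * N (i + 2) (l + 1) 0.
  have := adjN l; rewrite adj3E => /eqP.
  set a := (X in lcoef (X - _)); set b := (X in lcoef (_ - X)) => E.
  have {E} : a 0 - b 0 = 0 := eqP E.
  by rewrite /a /b !residueM; try exact: Ni; move/eqP; rewrite subr_eq0 => /eqP.
(* [H] treats the column pairs [(l + 1, l + 2)]; modulo 3, two distinct columns form such a pair in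
   one of the two orders. *)
have [->//|jk] := eqVneq j k.
have [->|kj1] := eqVneq k (j + 1).
  have := H (j - 1); rewrite subrK; congr (_ * N _ _ _ = N _ _ _ * _).
    by case: j {jk} => -[|[|[|//]]] ?; apply/val_inj.
  by case: j {jk} => -[|[|[|//]]] ?; apply/val_inj.
have -> : j = k + 1.
  move: jk kj1; case: j => -[|[|[|//]]] ?; case: k => -[|[|[|//]]] ? //= _ _;
  exact/val_inj.
have := H (k - 1); rewrite subrK => /esym; congr (N _ _ _ * _ = _ * N _ _ _).
  by case: k {jk kj1} => -[|[|[|//]]] ?; apply/val_inj.
by case: k {jk kj1} => -[|[|[|//]]] ?; apply/val_inj.
Qed.

End Lines.

(** * Neighbours of the next colour correspond to lines *)

Section LinesAndNeighbours.
Variable K : fieldType.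
Local Notation F := (laurent K).
Local Notation t := (lvar K).
Local Notation mono := (@lmono K).
Local Notation line := (unit + K + K * K)%type.
Implicit Types (g : GL3 K) (l : line).

(** Since the residue has rank at most one, all columns have residues on a common line, and its
    pivot is read off from the last row with nonzero residue. *)
Lemma residue_in_line (N : 'M[F]_3) : N \in unitmx -> mxint N ->
  mxint (t^-1 *: invmx N) -> ldeg (\det N) = - 2 ->
  exists l, mxint (line_mxV l *m N).
Proof.
move=> Nu Ni Nti dN; have minor i j k := residue_minors i j k Nu Ni Nti dN.
have m02 j k : N 2 j 0 * N 0 k 0 = N 2 k 0 * N 0 j 0.
  have := minor 1 j k; rewrite (_ : 1 + 1 = 2 :> 'I_3); last exact/val_inj.
  by rewrite (_ : 1 + 2 = 0 :> 'I_3)//; exact/val_inj.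
have m12 j k : N 1 j 0 * N 2 k 0 = N 1 k 0 * N 2 j 0.
  by have := minor 0 j k; rewrite !add0r.
have m01 j k : N 0 j 0 * N 1 k 0 = N 0 k 0 * N 1 j 0.
  have := minor 2 j k; rewrite (_ : 2 + 1 = 0 :> 'I_3); last exact/val_inj.
  by rewrite (_ : 2 + 2 = 1 :> 'I_3)//; exact/val_inj.
have ratio (a c x y : K) : c != 0 -> a * y = x * c -> x - a / c * y = 0.
  by move=> c0 E; rewrite mulrAC E mulfK// subrr.
have cuni0 i j (x y z : K) : ((cuni x y z *m N) i j) 0 =
    nth 0 [:: N 0 j 0 + x * N 1 j 0 + y * N 2 j 0; N 1 j 0 + z * N 2 j 0; N 2 j 0] i.
  have m0 c k : (mono 0 c * N k j) 0 = c * N k j 0.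
    have ci : lint (mono 0 c) by exact: lint_mono.
    by rewrite (residueM ci (Ni k j)) lmonoE eqxx.
  rewrite uni_mulE; case: i => -[|[|[|//]]] ? //=.
    by rewrite -!m0.
  by rewrite -!m0.
(* The inverse of [D_l] multiplies the rows off the pivot by [t], so exactly these rows must have
   zero residue. *)
have lineP l : (forall i j : 'I_3, (i : nat) != pivot l ->
    (let: (x, y, z) := lcrd l in
     (cuni (- x) (x * z - y) (- z) *m N) i j 0 = 0)) -> mxint (line_mxV l *m N).
  rewrite /line_mxV; case: (lcrd l) => -[x y] z H i j; rewrite -mulmxA dgm_mulE.
  have Ui := mxintM (@cuni_int K (- x) (x * z - y) (- z)) Ni.
  rewrite /lexp; case: eqP => [_|/eqP il].
    by apply: lintM (Ui i j); apply: lint_mono.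
  by rewrite opprK; apply/lint_residue0; split; [exact: Ui|exact: H].
have [[j nj]|H2] := pselect (exists j, N 2 j 0 != 0).
  exists (inr (N 0 j 0 / N 2 j 0, N 1 j 0 / N 2 j 0)).
  apply: lineP => i k; cbv beta iota delta [lcrd]; rewrite cuni0; case: i => -[|[|[|//]]] ? //= _.
    rewrite oppr0 !mul0r addr0 sub0r mulNr; apply: ratio => //.
    by rewrite mulrC m02 mulrC.
  by rewrite mulNr; apply: ratio => //; rewrite m12.
have {}H2 j : N 2 j 0 = 0 by apply/eqP/negPn/negP => nj; apply: H2; exists j.
have [[j nj]|H1] := pselect (exists j, N 1 j 0 != 0).
  exists (inl (inr (N 0 j 0 / N 1 j 0))).
  apply: lineP => i k; cbv beta iota delta [lcrd]; rewrite cuni0; case: i => -[|[|[|//]]] ? //= _.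
  rewrite H2 mulr0 addr0.
  by rewrite mulNr; apply: ratio => //; rewrite m01.
have {}H1 j : N 1 j 0 = 0 by apply/eqP/negPn/negP => nj; apply: H1; exists j.
exists (inl (inl tt)); apply: lineP => i k; cbv beta iota delta [lcrd]; rewrite cuni0.
by case: i => -[|[|[|//]]] ? //= _; rewrite ?H2 ?H1// mulr0 addr0.
Qed.

(** The product is a constant unitriangular matrix between two diagonal ones. With different pivots
    it would have [t] as a diagonal entry; with equal pivots the entries above the pivot are [t]
    times the differences of the coordinates, which must then vanish. *)
Lemma line_mx_inj l l' : mxint (line_mxV l *m line_mx l') -> l = l'.
Proof.
rewrite /line_mxV /line_mx => H.
pose i : 'I_3 := inord (pivot l').
have iE : i = pivot l' :> nat by rewrite inordK//; case: (l') => [[?|?]|?].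
have E : exists x y z, [/\ line_mxV l *m line_mx l' =
    dgm K (fun k => - lexp l k) *m cuni x y z *m dgm K (lexp l'),
    x = (lcrd l').1.1 - (lcrd l).1.1,
    y = (lcrd l').1.2 - (lcrd l).1.1 * (lcrd l').2 +
        ((lcrd l).1.1 * (lcrd l).2 - (lcrd l).1.2) &
    z = (lcrd l').2 - (lcrd l).2].
  rewrite /line_mxV /line_mx; case: (lcrd l) => -[x y] z; case: (lcrd l') => -[x' y'] z'.
  exists (x' - x), (y' - x * z' + (x * z - y)), (z' - z); split=> //.
  rewrite -!mulmxA; congr (_ *m _); rewrite !mulmxA; congr (_ *m _).
  by rewrite cuniM; congr cuni; ring.
move: H; rewrite -/(line_mxV l) -/(line_mx l'); case: E => x [y [z [-> xE yE zE]]].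
have EE j k : (dgm K (fun k => - lexp l k) *m cuni x y z *m dgm K (lexp l')) j k =
    mono (lexp l' k - lexp l j) (uni x y z j k).
  by rewrite mul_dgmE dgm_mulE cuniE !lmono_mul mul1r mulr1 addr0 addrC.
move=> H; have mono1 (c : K) : lint (mono 1 c) -> c = 0.
  by move=> /(_ 1); rewrite lmonoE eqxx; apply.
have pivE : pivot l' = pivot l.
  have := H i i; rewrite EE mxE iE {1}/lexp eqxx sub0r {1}/lexp.
  case: eqP => // _; rewrite opprK => /mono1/eqP.
  by case: (l') => [[?|?]|?] /=; rewrite oner_eq0.
have {EE} H (j k : 'I_3) : lint (mono (lexp l' k - lexp l j) (uni x y z j k)).
  by rewrite -EE.
move: pivE xE yE zE H.
case: l => [[[]|a]|[a b]]; case: l' {i iE} => [[[]|a']|[a' b']] //= _ -> -> -> H.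
  have := H 0 1; rewrite mxE /lexp /= sub0r opprK => /mono1/eqP.
  by rewrite subr_eq0 => /eqP ->.
have := H 0 2; rewrite mxE /lexp /= sub0r opprK => /mono1/eqP.
rewrite !mul0r subr0 sub0r subr_eq0 => /eqP ->.
have := H 1 2; rewrite mxE /lexp /= sub0r opprK => /mono1/eqP.
by rewrite subr_eq0 => /eqP ->.
Qed.

Lemma line_GL3_subproof g l : val g *m line_mx l \in unitmx.
Proof. by rewrite unitmx_mul (valP g) line_mx_unit. Qed.

Definition line_nbr g l : vertex K := vtx (mkGL3 (line_GL3_subproof g l)).

Lemma line_nbr_inj g : injective (line_nbr g).
Proof.
move=> l l' /vtx_eqP[c [w [c0 Ww]]] /= E; apply: line_mx_inj.
have gu : val g \in unitmx := valP g.
have wu := W_unit Ww; have w0 : \det w != 0 by rewrite -unitmx_neq0.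
have {}E : line_mx l' = c *: (line_mx l *m w).
  by rewrite -[LHS](mulKmx gu) E -mulmxA -scalemxAr mulKmx.
(* Both line matrices have determinants of degree -2, so the scalar has degree 0 and preserves
   integrality. *)
have dc : ldeg c = 0.
  have l0 k : \det (line_mx k : 'M[F]_3) != 0 by rewrite -unitmx_neq0 line_mx_unit.
  have lw0 : \det (line_mx l *m w) != 0 by rewrite -unitmx_neq0 unitmx_mul line_mx_unit.
  have := congr1 (fun A : 'M[F]_3 => ldeg (\det A)) E => /=.
  rewrite (ldeg_detZ c0 lw0) (ldeg_detM (l0 l) w0) (W_ldeg Ww) !ldeg_line; lia.
have -> : line_mxV l *m line_mx l' = c *: w.
  by rewrite E -scalemxAr -invmx_line mulKmx// line_mx_unit.
have ci : lint c by apply/lint_ldeg; rewrite ?dc.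
by move=> i j; rewrite mxE; exact: lintM ci (W_int Ww i j).
Qed.

(** Once [line_mxV l *m N] is integral, its determinant has degree [2 - 2 = 0], so it lies in [W]
    and [N] and [line_mx l] define the same vertex. *)
Lemma neighbour_set g :
  [set y | Defs.adjacent (vtx g) y /\ color y = color (vtx g) + 1] =
  [set line_nbr g l | l in [set: line]].
Proof.
have gu : val g \in unitmx := valP g.
apply/seteqP; split=> [y /neighbourP[N [h [Nu Ni Nti dN [hE ->]]]]|_ [l _ <-]].
  have [l li] := residue_in_line Nu Ni Nti dN; exists l => //.
  have Vu : line_mxV l \in unitmx by rewrite -invmx_line unitmx_inv line_mx_unit.
  have V0 : \det (line_mxV l) != 0 by rewrite -unitmx_neq0.
  have N0 : \det N != 0 by rewrite -unitmx_neq0.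
  apply/vtx_eqP; exists 1, (line_mxV l *m N); split; first exact: oner_neq0.
    apply: W_mxint => //; first by rewrite det_mulmx mulf_neq0.
    by rewrite (ldeg_detM V0 N0) ldeg_lineV dN.
  rewrite scale1r /= hE -mulmxA; congr (_ *m _).
  by rewrite mulmxA line_mxK mul1mx.
apply/neighbourP; exists (line_mx l), (mkGL3 (line_GL3_subproof g l)).
split; [exact: line_mx_unit|exact: line_mx_int|exact: line_mxV_int|exact: ldeg_line|].
by split.
Qed.

End LinesAndNeighbours.

Section AplusLines.
Variable K : finFieldType.
Local Notation line := (unit + K + K * K)%type.

Lemma Aplus_vtx (C : nmodType) (f : vertex K -> C) (g : GL3 K) :
  Aplus f (vtx g) = \sum_(l : line) f (line_nbr g l).
Proof.
rewrite /Aplus neighbour_set fsbig_image => [|l l' _ _]; last exact: line_nbr_inj.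
rewrite [RHS](fsbig_seq _ _ (index_enum_uniq _)); apply: eq_fsbigl.
by apply/seteqP; split=> l _ //=; rewrite mem_index_enum.
Qed.

End AplusLines.

(** * The operator in the coordinates (m, n) *)

Section Orbits.
Variable K : fieldType.
Local Notation F := (laurent K).
Local Notation mono := (@lmono K).
Local Notation line := (unit + K + K * K)%type.
Implicit Types (g h : GL3 K) (a b : nat -> int).

Lemma orb_vtxP g h : orb (vtx g) = orb (vtx h) <->
  exists u : GL3poly K, vtx h = vtx (gamma_mul u g).
Proof.
split=> [gh|[u ghu]].
  have /asboolP[u ->] : orbit_rel (vtx g) (vtx h) by apply/eqmodP.
  by exists u; exact: gamma_actE.
apply/eqmodP/asboolP; exists u; rewrite ghu; apply/esym.
exact: gamma_actE.
Qed.

Lemma dgm_unit a : dgm K a \in unitmx.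
Proof. by rewrite unitmx_neq0 det_dgm_neq0. Qed.

(** Exponents may be negative or out of order, as they are for neighbours before normalisation to
    some [vmn]. *)
Definition diag_orb a : Defs.orbit K := orb (vtx (mkGL3 (dgm_unit a))).

Definition tri (x y z : int) (k : nat) : int := nth 0 [:: x; y; z] k.

Lemma dgm_xmn m n : val (xmn K m n) = dgm K (tri m n 0).
Proof.
apply/matrixP => i j; rewrite !mxE lvarX.
by case: i => -[|[|[|//]]] ?; case: j => -[|[|[|//]]] ?.
Qed.

Lemma vtx_val g h : val g = val h -> vtx g = vtx h.
Proof. by move=> gh; congr vtx; apply/val_inj. Qed.

Lemma vmnE m n : vmn K m n = diag_orb (tri m n 0).
Proof. by congr orb; apply: vtx_val; exact: dgm_xmn. Qed.

Lemma diag_orb_shift c a b : (forall i : 'I_3, b i = c + a i) ->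
  diag_orb a = diag_orb b.
Proof.
move=> abc; congr orb; apply/vtx_eqP; exists (mono c 1), 1%:M; split.
- by apply: lmono_neq0; exact: oner_neq0.
- exact: W1.
- apply/matrixP => i j; rewrite mulmx1 !mxE abc.
  by case: eqP => _; rewrite ?mulr1n ?mulr0n ?mulr0// lmono_mul mulr1.
Qed.

Lemma W_perm (s : 'S_3) : W (perm_mx s : 'M[F]_3).
Proof.
have m1 : (-1 : F) = mono 0 (-1) by rewrite -lmonoN.
have n1 : (-1 : K) != 0 by rewrite oppr_eq0 oner_neq0.
apply: W_mxint.
- by move=> i j; rewrite !mxE; case: eqP => _; [exact: lint1|exact: lint0].
- by rewrite det_perm expf_neq0// oppr_eq0 oner_neq0.
- rewrite det_perm ldegX; last by rewrite oppr_eq0 oner_neq0.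
  by rewrite m1 ldeg_mono// mul0rn.
Qed.

(** A permutation matrix is polynomial and its inverse lies in [W], so conjugation by it stays in
    the orbit. *)
Lemma diag_orb_perm (s : 'S_3) a b : (forall i : 'I_3, b i = a (s i)) ->
  diag_orb a = diag_orb b.
Proof.
move=> bas; apply/orb_vtxP.
have Pu : perm_mx s \in @unitmx {poly K} 3 by exact: unitmx_perm.
exists (mkGL3poly Pu); apply/esym/vtx_eqP; exists 1, (perm_mx s^-1); split.
- exact: oner_neq0.
- exact: W_perm.
- rewrite scale1r /= map_perm_mx -row_permE -col_permE.
  by apply/matrixP => i j; rewrite !mxE bas (inj_eq perm_inj).
Qed.

Lemma diag_orb_swap01 x y z : diag_orb (tri x y z) = diag_orb (tri y x z).
Proof.
apply: (@diag_orb_perm (tperm 0 1)) => i.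
by case: i => -[|[|[|//]]] ?; rewrite permE /=.
Qed.

Lemma diag_orb_swap12 x y z : diag_orb (tri x y z) = diag_orb (tri x z y).
Proof.
apply: (@diag_orb_perm (tperm 1 2)) => i.
by case: i => -[|[|[|//]]] ?; rewrite permE /=.
Qed.

(** Conjugation multiplies the entries above the diagonal by [t^(m - n)], [t^m] and [t^n]; the
    ordering of the exponents makes the result polynomial. *)
Lemma dgm_cuni (m n : nat) (x y z : K) : (n <= m)%N ->
  dgm K (tri m n 0) *m cuni x y z =
  map_mx (@lpoly K) (uni (x *: 'X^(m - n)) (y *: 'X^m) (z *: 'X^n)) *m
  dgm K (tri m n 0).
Proof.
move=> nm; apply/matrixP => i j; rewrite dgm_mulE mul_dgmE cuniE lmono_mul mul1r addr0 !mxE.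
case: i => -[|[|[|//]]] ?; case: j => -[|[|[|//]]] ? /=;
  rewrite ?lmono00 ?rmorph0 ?mul0r ?rmorph1 ?mul1r// lpolyX_mono lmono_mul mulr1//;
  by congr lmono; rewrite /tri /= ?addr0//; lia.
Qed.

(** The unitriangular part of [line_mx l], moved to the left, is absorbed by the polynomial group;
    the diagonal part, which depends on the pivot alone, remains. *)
Lemma line_nbr_orb (u : GL3poly K) (m n : nat) (l : line) : (n <= m)%N ->
  orb (line_nbr (gamma_mul u (xmn K m n)) l) =
  diag_orb (fun k => tri m n 0 k + lexp l k).
Proof.
move=> nm; apply/esym/orb_vtxP; rewrite /line_nbr.
case E : (lcrd l) => [[x y] z].
have vu : uni (x *: 'X^(m - n)) (y *: 'X^m) (z *: 'X^n) \in @unitmx {poly K} 3.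
  by rewrite unitmxE det_uni unitr1.
have uvu : val u *m uni (x *: 'X^(m - n)) (y *: 'X^m) (z *: 'X^n) \in unitmx.
  by rewrite unitmx_mul (valP u).
exists (mkGL3poly uvu); apply: vtx_val => /=.
rewrite [diag_mx _]dgm_xmn /line_mx E map_mxM -!mulmxA; congr (_ *m _).
by rewrite mulmxA dgm_cuni// -mulmxA dgmM.
Qed.

Lemma vmn_inj m n m' n' : (n <= m)%N -> (n' <= m')%N ->
  vmn K m n = vmn K m' n' -> (m, n) = (m', n').
Proof.
move=> nm nm'; rewrite !vmnE => /orb_vtxP[u] /esym/vtx_eqP[c [w [c0 Ww /= E]]].
set U := map_mx _ _ in E.
have wu := W_unit Ww; have w0 : \det w != 0 by rewrite -unitmx_neq0.
have U0 : ldeg (\det U) = 0.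
  by rewrite det_map_mx; apply: lpoly_unit_ldeg; rewrite -unitmxE (valP u).
have detU : \det U != 0.
  by rewrite det_map_mx -unitfE; apply: rmorph_unit; rewrite -unitmxE (valP u).
have X0 : \det (U *m dgm K (tri m n 0)) != 0.
  by rewrite det_mulmx mulf_neq0// det_dgm_neq0.
have Xw0 : \det (U *m dgm K (tri m n 0) *m w) != 0 by rewrite det_mulmx mulf_neq0.
have sumE : m'%:Z + n'%:Z = 3 * ldeg c + (m%:Z + n%:Z).
  have := congr1 (fun A : 'M[F]_3 => ldeg (\det A)) E => /=.
  rewrite (ldeg_detZ c0 Xw0) (ldeg_detM X0 w0) (ldeg_detM detU (det_dgm_neq0 K _)).
  by rewrite U0 (W_ldeg Ww) !ldeg_dgm /tri/= !addr0 add0r.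
(* [U = c^-1 X' w^-1 X^-1] bounds the degrees of the entries of [U] *)
have UE : U *m dgm K (tri m n 0) = c^-1 *: (dgm K (tri m' n' 0) *m invmx w).
  by rewrite E -scalemxAl mulmxK// scalerA mulVf// scale1r.
have bound (i j : 'I_3) : val u i j != 0 ->
    0 <= tri m' n' 0 i - tri m n 0 j - ldeg c.
  move=> uij; apply: (lpoly_lbd_ge0 uij).
  have -> : lpoly (val u i j) =
      c^-1 * (mono (tri m' n' 0 i) 1 * invmx w i j) * mono (- tri m n 0 j) 1.
    have <- : U i j * mono (tri m n 0 j) 1 =
        c^-1 * (mono (tri m' n' 0 i) 1 * invmx w i j).
      by rewrite -mul_dgmE UE -dgm_mulE mxE.
    by rewrite -mulrA lmono_mul subrr mulr1 (_ : mono 0 1 = 1)// mulr1 mxE.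
  have c1 : lbd (c^-1 : F)%R (- ldeg c).
    by rewrite -ldegV//; have [] := @ldegP K c^-1 _; rewrite ?invr_eq0.
  have iw : lbd (invmx w i j) 0 by exact: (W_int (WV Ww)).
  have lbdM (f g : F) N M : lbd f N -> lbd g M -> lbd (f * g)%R (N + M).
    exact: lmul_lbd.
  have L := lbdM _ _ _ _ (lbdM _ _ _ _ c1 (lbdM _ _ _ _ (@lmono_lbd K (tri m' n' 0 i) 1) iw))
    (@lmono_lbd K (- tri m n 0 j) 1).
  by apply: lbdW L; lia.
(* A nonzero determinant has a nonzero term in its Leibniz expansion. *)
have [s su] : exists s : 'S_3, forall i, val u i (s i) != 0.
  apply: contrapT => H; have : \det (val u) != 0.
    by apply: contraNneq detU => u0; rewrite det_map_mx u0 rmorph0.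
  rewrite /determinant big1 ?eqxx// => s _.
  suff -> : \prod_i val u i (s i) = 0 by rewrite mulr0.
  apply/eqP/prodf_eq0.
  have [i ui] : exists i, val u i (s i) == 0.
    by apply: contrapT => H'; apply: H; exists s => i; apply/negP => ui; apply: H'; exists i.
  by exists i.
(* By [sumE] the three nonnegative quantities add up to 0, so all vanish: the two exponent triples
   agree up to a permutation and a shift, and both are sorted with last entry 0. *)
have := bound 0 (s 0) (su _); have := bound 1 (s 1) (su _); have := bound 2 (s 2) (su _).
have s01 : s 0 != s 1 by rewrite (inj_eq perm_inj).
have s02 : s 0 != s 2 by rewrite (inj_eq perm_inj).
have s12 : s 1 != s 2 by rewrite (inj_eq perm_inj).
move: s01 s02 s12 sumE; rewrite /tri /=; move: (ldeg c) => d.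
move: (s 0) (s 1) (s 2) => i j k.
case: i => -[|[|[|//]]] ?; case: j => -[|[|[|//]]] ?; case: k => -[|[|[|//]]] ? //= _ _ _;
  move=> H1 H2 H3 H4; congr pair; lia.
Qed.

End Orbits.

Section AwPlus.
Variable K : finFieldType.

(** The terms come from the 1, [q] and [q^2] lines with pivot 0, 1 and 2. Up to homothety they lead
    to the exponents [(m + 1, n, 0)], [(m, n + 1, 0)] and [(m - 1, n - 1, 0)], which are sorted
    again on the walls. *)
Lemma Aw_plus_vmn (C : nmodType) (f : Defs.orbit K -> C) (m n : nat) : (n <= m)%N ->
  Aw_plus f (vmn K m n) = f (vmn K m.+1 n) +
    f (if (n < m)%N then vmn K m n.+1 else vmn K m.+1 m) *+ #|K| +
    f (if n is n'.+1 then vmn K m.-1 n' else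
       if m == 0%N then vmn K 1 0 else vmn K m 1) *+ #|K| ^ 2.
Proof.
move=> nm; rewrite /Aw_plus.
have [u ->] : exists u, repr (vmn K m n) = vtx (gamma_mul u (xmn K m n)).
  have /asboolP[u ->] : orbit_rel (vtx (xmn K m n)) (repr (vmn K m n)).
    by apply/eqmodP; rewrite reprK.
  by exists u; exact: gamma_actE.
rewrite Aplus_vtx big_sumType big_sumType /=.
have -> : f (vmn K m.+1 n) = \sum_(i : unit)
    (f \o @orb K) (line_nbr (gamma_mul u (xmn K m n)) (inl (inl i))).
  rewrite (big_pred1 tt) => [|[]//]; rewrite /= line_nbr_orb// vmnE; congr f.
  apply/esym/(@diag_orb_shift _ 1) => -[[|[|[|//]]] ?]; rewrite /tri /lexp /=; lia.
congr (_ + _ + _).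
  rewrite -sumr_const; apply: eq_bigr => x _ /=; rewrite line_nbr_orb//; congr f.
  transitivity (diag_orb K (tri m n.+1 0)); last first.
    case: ifPn => [_|]; first by rewrite vmnE.
    rewrite -leqNgt => mn; rewrite vmnE diag_orb_swap01.
    by have -> : n = m by apply/eqP; rewrite eqn_leq nm.
  by apply: (@diag_orb_shift _ 1) => -[[|[|[|//]]] ?]; rewrite /tri /lexp /=; lia.
rewrite -[(#|K| ^ 2)%N]mulnn -card_prod -sumr_const.
apply: eq_bigr => x _ /=; rewrite line_nbr_orb//; congr f.
case: n nm => [|n] nm.
  transitivity (diag_orb K (tri m 0 1)).
    by apply: (@diag_orb_shift _ 1) => -[[|[|[|//]]] ?]; rewrite /tri /lexp /=; lia.
  by rewrite diag_orb_swap12; case: eqP => [->|_]; rewrite vmnE// diag_orb_swap01.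
rewrite vmnE; apply: (@diag_orb_shift _ 0).
by move=> -[[|[|[|//]]] ?]; rewrite /tri /lexp /=; lia.
Qed.

End AwPlus.

(** * Approximate eigenvectors *)

Section FiniteSums.
Variables (R : realType) (T : choiceType).
Implicit Types (D : set T) (a b : T -> R) (s : seq T).

(** The sum over [D] is a supremum of finite subsums, enumerated here by lists without
    repetition. *)
Lemma esum_le_seq D a (M : R) :
  (forall s, uniq s -> (forall x, x \in s -> D x) -> \sum_(x <- s) a x <= M) ->
  (\esum_(x in D) (a x)%:E <= M%:E)%E.
Proof.
move=> aM; apply: ge_ereal_sup => _ [A [Afin AD] <-].
have [s [us sA]] : exists s : seq T, uniq s /\ A = [set` s].
  have [X ->] := finite_fsetP.1 Afin.
  by exists (finmap.enum_fset X); split; [exact: finmap.fset_uniq|].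
rewrite sA in AD *; rewrite -fsbig_seq// sumEFin lee_fin; exact: aM.
Qed.

Lemma esum_ge_seq D a s : uniq s -> (forall x, x \in s -> D x) ->
  ((\sum_(x <- s) a x)%:E <= \esum_(x in D) (a x)%:E)%E.
Proof.
move=> us sD; apply: esum_ge; exists [set` s].
  by split; [exact: finite_seq|exact: sD].
by rewrite -fsbig_seq// sumEFin.
Qed.

Lemma ler_sum_sub (s s' : seq T) b : uniq s -> {subset s <= s'} ->
  (forall x, 0 <= b x) -> \sum_(x <- s) b x <= \sum_(x <- s') b x.
Proof.
move=> us ss b0; apply: (@le_trans _ _ (\sum_(x <- undup s') b x)).
  have [s'' us''] : exists s'', perm_eq (s ++ s'') (undup s').
    exists [seq x <- undup s' | x \notin s]; apply: uniq_perm.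
    - rewrite cat_uniq us filter_uniq ?undup_uniq// andbT.
      by apply/hasPn => x; rewrite mem_filter => /andP[].
    - exact: undup_uniq.
    - move=> x; rewrite mem_cat mem_filter mem_undup /=.
      by have := ss x; case: (x \in s) => //= ->.
  by rewrite -(perm_big _ us'') big_cat lerDl; apply: sumr_ge0.
elim: s' {ss} => [|x s' IH]; first by [].
rewrite /= big_cons; case: ifP => _; last by rewrite big_cons lerD2l.
by apply: (le_trans IH); rewrite lerDr.
Qed.

Lemma esum_le_supp D a b s : (forall x, 0 <= b x) ->
  (forall x, D x -> x \notin s -> a x = 0) ->
  (forall x, D x -> a x <= b x) ->
  (\esum_(x in D) (a x)%:E <= (\sum_(x <- s) b x)%:E)%E.
Proof.
move=> b0 a0 ab; apply: esum_le_seq => s' us' s'D.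
apply: (@le_trans _ _ (\sum_(x <- [seq x <- s' | x \in s]) b x)); last first.
  apply: ler_sum_sub => //; first exact: filter_uniq.
  by move=> x; rewrite mem_filter => /andP[].
rewrite big_filter (bigID (mem s))/= [X in _ + X]big1_seq ?addr0.
  rewrite big_seq_cond [leRHS]big_seq_cond.
  by apply: ler_sum => x /andP[xs _]; apply: ab; exact: s'D.
by move=> x /andP[xs xs']; apply: a0 => //; exact: s'D.
Qed.

End FiniteSums.

(** * Functions of [(m, n)] on the quotient, and a criterion for the spectrum *)

Section FunctionsOnQuotient.
Variables (R : realType) (K : finFieldType).
Local Notation C := R[i].
Local Notation q := (#|K|%:R : R).
Implicit Types (phi : nat -> nat -> C) (f : Defs.orbit K -> C).

Lemma card_ge2 : (1 < #|K|)%N.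
Proof. exact: card_finNzRing_gt1. Qed.

Lemma q_ge2 : 2 <= q.
Proof. by rewrite ler_nat card_ge2. Qed.

(* only the values [phi m n] with [n <= m] matter *)
Definition of_vmn phi : Defs.orbit K -> C := fun X =>
  let p := xget (0%N, 0%N) [set p | (p.2 <= p.1)%N /\ X = vmn K p.1 p.2] in
  phi p.1 p.2.

Lemma of_vmnE phi m n : (n <= m)%N -> of_vmn phi (vmn K m n) = phi m n.
Proof.
move=> nm; rewrite /of_vmn; set P := [set p | _].
have [p2 pE] := @xgetPex _ (0%N, 0%N) P (ex_intro _ (m, n) (conj nm erefl)).
by have [-> ->] := vmn_inj nm p2 pE.
Qed.

Definition Ahat phi (m n : nat) : C := phi m.+1 n +
  #|K|%:R * (if (n < m)%N then phi m n.+1 else phi m.+1 m) +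
  #|K|%:R ^+ 2 * (if n is n'.+1 then phi m.-1 n' else
                  if m == 0%N then phi 1 0 else phi m 1).

Lemma Aw_plus_of_vmn phi m n : (n <= m)%N ->
  Aw_plus (of_vmn phi) (vmn K m n) = Ahat phi m n.
Proof.
move=> nm; rewrite Aw_plus_vmn// /Ahat -natrX !mulr_natl of_vmnE ?leqW//.
congr (_ + _ *+ _ + _ *+ _).
  by case: ifP => // nm'; rewrite of_vmnE.
case: n nm => [|n] nm; last by rewrite of_vmnE//; case: m nm.
by case: m {nm} => [|m]; rewrite of_vmnE.
Qed.

Lemma weight_gt0 m n : 0 < weight R K m n.
Proof.
have q0 : 0 < q by apply: lt_le_trans q_ge2.
by rewrite /weight; case: ifP => _; [|case: ifP => _];
  rewrite ?divr_gt0 ?invr_gt0 ?exprn_gt0 ?addr_gt0 ?exprn_gt0.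
Qed.

Lemma weight_ge m n : (0 < m)%N -> (q ^+ (2 * m))^-1 <= weight R K m n.
Proof.
case: m => // m _; rewrite /weight /=; case: ifP => // _.
rewrite ler_peMl ?invr_ge0 ?exprn_ge0//.
by rewrite lerDr.
Qed.

Lemma weight_le m n : weight R K m n <= (q + 1) / q ^+ (2 * m).
Proof.
have q0 : 0 <= q by [].
rewrite /weight; case: eqP => [->|_]; last first.
  by case: ifP => // _; rewrite ler_peMl ?invr_ge0 ?exprn_ge0// lerDr.
rewrite muln0 expr0 divr1; apply: (@le_trans _ _ 1); last by rewrite lerDr.
by rewrite invf_le1 ?lerDr ?addr_ge0 ?exprn_ge0// ltr_wpDl// addr_ge0// exprn_ge0.
Qed.

Lemma sqnorm_ge0 f : (0 <= sqnorm f)%E.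
Proof.
apply: esum_ge0 => p _; rewrite lee_fin mulr_ge0 ?sqr_ge0//.
exact/ltW/weight_gt0.
Qed.

(* Weyl's criterion, with bounds [M1] and [M2] in place of the norms *)
Lemma approx_eigenvalue (lambda : C) :
  (forall eps : R, 0 < eps -> exists f, exists M1 M2 : R,
    [/\ 0 < M1, (M1%:E <= sqnorm f < +oo)%E,
        (sqnorm (fun X => Aw_plus f X - lambda * f X)%R <= M2%:E)%E &
        M2 <= eps * M1]) ->
  spectrum (@Aw_plus K C) lambda.
Proof.
move=> H [B [_ _ [M BM]] AB].
have M0 : 0 < 2 * (M ^+ 2 + 1) by rewrite mulr_gt0// ltr_wpDl// sqr_ge0.
(* With [x] and [y] the squared norms of [f] and [g], an inverse with constant [M] would give
   [x <= M^2 y <= M^2 eps x], and this [eps] makes the right-hand side smaller than [x]. *)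
have [|f [M1 [M2 [M10 /andP[M1f foo] fM2 M21]]]] := H (2 * (M ^+ 2 + 1))^-1.
  by rewrite invr_gt0.
have [Bf _] := AB f foo.
set g := (fun X => _) in fM2 Bf.
have gfin : L2w g by apply: le_lt_trans fM2 _; rewrite ltry.
have := BM g gfin; rewrite Bf /L2norm.
have f_fin : sqnorm f \is a fin_num by rewrite ge0_fin_numE ?sqnorm_ge0.
have g_fin : sqnorm g \is a fin_num by rewrite ge0_fin_numE ?sqnorm_ge0.
move: M1f fM2; rewrite -(fineK f_fin) -(fineK g_fin) !lee_fin /=.
have := fine_ge0 (sqnorm_ge0 g).
move: (fine (sqnorm f)) (fine (sqnorm g)) => x y y0 M1x yM2 xy.
have x0 : 0 < x by apply: lt_le_trans M1x.
have : x <= M ^+ 2 * y.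
  rewrite -[x]sqr_sqrtr ?(ltW x0)// -[y]sqr_sqrtr// -exprMn ler_sqr ?nnegrE ?sqrtr_ge0//.
  by apply: le_trans xy; rewrite sqrtr_ge0.
apply/negP; rewrite -ltNge; apply: (@le_lt_trans _ _ (M ^+ 2 * ((2 * (M ^+ 2 + 1))^-1 * x))).
  rewrite ler_wpM2l ?sqr_ge0//; apply: (le_trans yM2); apply: (le_trans M21).
  by rewrite ler_wpM2l// ltW// invr_gt0.
rewrite mulrA -[ltRHS]mul1r ltr_pM2r// ltr_pdivrMr// mul1r.
by have := sqr_ge0 M; lra.
Qed.

End FunctionsOnQuotient.

(** * Moduli of complex numbers and points of the unit circle *)

Section Modulus.
Variable R : realType.
Implicit Types (x y : R[i]) (a b : R).

Lemma normcD x y : normc (x + y) <= normc x + normc y.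
Proof. exact: le_normcD. Qed.

Lemma normc_ge0 x : 0 <= normc x.
Proof. by case: x => a b; exact: sqrtr_ge0. Qed.

Lemma normc_real a : normc a%:C%C = `|a|.
Proof. by rewrite /= expr0n addr0 sqrtr_sqr. Qed.

Lemma normcX x n : normc (x ^+ n) = normc x ^+ n.
Proof. by elim: n => [|n IHn]; rewrite ?normc1// !exprS normcM IHn. Qed.

Lemma normc_nat n : normc (n%:R : R[i]) = n%:R.
Proof. by rewrite -(rmorph_nat (real_complex R)) normc_real normr_nat. Qed.

Lemma norm1_normc x : `|x| = 1 -> normc x = 1.
Proof. by case: x => a b; rewrite normc_def => -[]. Qed.

Lemma cisD a b : cis (a + b) = cis a * cis b.
Proof.
rewrite /cis cosD sinD; apply/eqP; rewrite eq_complex /=.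
by apply/andP; split; apply/eqP => //; rewrite addrC.
Qed.

Lemma normc_cis a : normc (cis a) = 1.
Proof. by rewrite /= cos2Dsin2 sqrtr1. Qed.

Lemma cis0 : cis (0 : R) = 1.
Proof. by rewrite /cis cos0 sin0. Qed.

Lemma cis2pi : cis (2 * trigo.pi : R) = 1.
Proof. by rewrite /cis mulr_natl cos2pi sin2pi. Qed.

End Modulus.

(** * Tent functions *)

Section Tent.
Variable R : realFieldType.
Implicit Types N c x y : R.

Definition tent N c x : R := Num.max 0 (1 - `|x - c| / N).

Lemma tent_ge0 N c x : 0 <= tent N c x.
Proof. by rewrite le_max lexx. Qed.

Lemma tent_le1 N c x : 0 < N -> tent N c x <= 1.
Proof.
move=> N0; rewrite /tent ge_max ler01 gerBl.
by rewrite divr_ge0// ltW.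
Qed.

Lemma tent_lip N c x y : 0 < N -> `|tent N c x - tent N c y| <= `|x - y| / N.
Proof.
move=> N0; have maxlip (a b : R) : `|Num.max 0 a - Num.max 0 b| <= `|a - b|.
  have := ler_norm (a - b); have := ler_norm (b - a); rewrite distrC.
  rewrite !maxEle; case: ifP => a0; case: ifP => b0; rewrite ?ler_norml; lra.
apply: (le_trans (maxlip _ _)).
have -> : 1 - `|x - c| / N - (1 - `|y - c| / N) = (`|y - c| - `|x - c|) / N.
  by field; rewrite gt_eqF.
rewrite normrM [`|N^-1|]ger0_norm ?invr_ge0 ?(ltW N0)// ler_pM2r ?invr_gt0//.
apply: (le_trans (ler_dist_dist _ _)).
by rewrite opprB addrA subrK distrC.
Qed.

Lemma tent_supp N c x : 0 < N -> N <= `|x - c| -> tent N c x = 0.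
Proof.
move=> N0 xN; apply/max_idPl; rewrite subr_le0 ler_pdivlMr// mul1r.
exact: xN.
Qed.

Lemma tent_half N c x : 0 < N -> `|x - c| <= N / 2 -> 2^-1 <= tent N c x.
Proof.
move=> N0 xN; rewrite /tent le_max; apply/orP; right.
have : `|x - c| / N <= 2^-1 by rewrite ler_pdivrMr// mulrC.
by lra.
Qed.

End Tent.

(** * Square integrable eigenfunctions *)

Section Eigenvalues.
Variables (R : realType) (K : finFieldType).
Local Notation C := R[i].
Local Notation q := (#|K|%:R : R).
Local Notation Q := (#|K|%:R : C).
Implicit Types (phi : nat -> nat -> C).

Lemma sqnorm_of_vmn phi : sqnorm (of_vmn (K := K) phi) =
  (\esum_(p in [set p : nat * nat | (p.2 <= p.1)%N])
    (normc (phi p.1 p.2) ^+ 2 * weight R K p.1 p.2)%:E)%E.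
Proof. by apply: eq_esum => -[m n] /= nm; rewrite of_vmnE. Qed.

Lemma sqnorm_residual phi (lambda : C) :
  sqnorm (fun X => Aw_plus (of_vmn (K := K) phi) X - lambda * of_vmn phi X) =
  (\esum_(p in [set p : nat * nat | (p.2 <= p.1)%N])
    (normc (Ahat K phi p.1 p.2 - lambda * phi p.1 p.2) ^+ 2 *
     weight R K p.1 p.2)%:E)%E.
Proof. by apply: eq_esum => -[m n] /= nm; rewrite of_vmnE// Aw_plus_of_vmn. Qed.

Lemma sum_half_le2 n : \sum_(k <- iota 0 n) (2^-1 : R) ^+ k <= 2.
Proof.
have -> : \sum_(k <- iota 0 n) (2^-1 : R) ^+ k = 2 - 2 * 2^-1 ^+ n.
  elim: n => [|n IHn]; first by rewrite big_nil expr0; ring.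
  rewrite -addn1 iotaD big_cat /= IHn big_seq1 add0n addn1 exprS mulrA divff// mul1r; ring.
by rewrite gerBl mulr_ge0// exprn_ge0// invr_ge0.
Qed.

(** As [q >= 2] and [n <= m], the decay [q^(-2 m)] is at least as fast as [2^(-m - n)], a product of
    two geometric sequences. *)
Lemma weight_le_geometric m n : (n <= m)%N ->
  weight R K m n <= (q + 1) * (2^-1 ^+ m * 2^-1 ^+ n).
Proof.
move=> nm; apply: (le_trans (weight_le R K m n)); rewrite ler_pM2l; last first.
  by rewrite ltr_wpDl.
rewrite -exprD -exprVn; apply: (@le_trans _ _ (2^-1 ^+ (2 * m))).
  rewrite lerXn2r ?nnegrE ?invr_ge0// lef_pV2 ?posrE//; first exact: q_ge2.
  by rewrite (lt_le_trans _ (q_ge2 R K)).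
by rewrite ler_wiXn2l ?invr_ge0 ?invf_le1 ?ler1n// mul2n -addnn leq_add2l.
Qed.

Lemma one_in_L2w : (\esum_(p in [set p : nat * nat | (p.2 <= p.1)%N])
  (weight R K p.1 p.2)%:E <= (4 * (q + 1))%:E)%E.
Proof.
apply: esum_le_seq => s us sD.
pose b (p : nat * nat) : R := (q + 1) * (2^-1 ^+ p.1 * 2^-1 ^+ p.2).
have b0 p : 0 <= b p by rewrite /b !mulr_ge0 ?exprn_ge0 ?invr_ge0 ?addr_ge0.
apply: (@le_trans _ _ (\sum_(p <- s) b p)).
  rewrite big_seq [leRHS]big_seq; apply: ler_sum => p ps.
  exact/weight_le_geometric/sD.
pose B := (\max_(p <- s) (p.1 + p.2)).+1.
apply: (@le_trans _ _ (\sum_(p <- [seq (m, n) | m <- iota 0 B, n <- iota 0 B]) b p)).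
  apply: ler_sum_sub => // -[m n] ps; apply/allpairsP; exists (m, n).
  have mnB : (m + n < B)%N.
    by rewrite ltnS (big_rem _ ps) /= leq_maxl.
  rewrite !mem_iota /=; split=> //; lia.
rewrite big_allpairs /b /=.
under eq_bigr => m _ do rewrite -mulr_sumr -mulr_sumr.
rewrite -mulr_sumr -mulr_suml mulrC ler_pM2r; last by rewrite ltr_wpDl.
rewrite (_ : 4 = 2 * 2 :> R); last by rewrite -natrM.
have S0 : 0 <= \sum_(k <- iota 0 B) (2^-1 : R) ^+ k.
  by apply: sumr_ge0 => k _; rewrite exprn_ge0// invr_ge0.
exact: (ler_pM S0 S0 (sum_half_le2 B) (sum_half_le2 B)).
Qed.

(** Each neighbour involved has [m + n] larger by 1 modulo 3, so every term of the operator
    multiplies [w^(m + n)] by [w]. The eigenfunction is exact, whence the residual bound 0. *)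
Lemma Sigma0_spectrum (w : C) : w ^+ 3 = 1 -> normc w = 1 ->
  spectrum (@Aw_plus K C) ((q ^+ 2 + q + 1)%:C%C * w).
Proof.
move=> w3 w1; apply: approx_eigenvalue => e e0.
pose phi m n := w ^+ (m + n).
have phi1 m n : normc (phi m n) = 1 by rewrite normcX w1 expr1n.
exists (of_vmn phi), (weight R K 0 0), 0; split.
- exact: weight_gt0.
- rewrite sqnorm_of_vmn; under eq_esum => p _ do rewrite phi1 expr1n mul1r.
  apply/andP; split; last by rewrite (le_lt_trans one_in_L2w) ?ltry.
  have := @esum_ge_seq R _ [set p : nat * nat | (p.2 <= p.1)%N]
    (fun p => weight R K p.1 p.2) [:: (0%N, 0%N)].
  by rewrite big_seq1; apply => // x; rewrite inE => /eqP ->.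
- rewrite sqnorm_residual esum1// => -[m n] /= nm.
  suff -> : Ahat K phi m n = (q ^+ 2 + q + 1)%:C%C * w * phi m n.
    by rewrite subrr normc0 expr0n mul0r.
  have -> : Ahat K phi m n = w ^+ (m + n).+1 + Q * w ^+ (m + n).+1 +
      Q ^+ 2 * w ^+ (m + n).+1.
    rewrite /Ahat /phi addSn; congr (_ + _ * _ + _ * _).
      case: ltnP => mn; first by rewrite addnS.
      by have -> : n = m by apply/eqP; rewrite eqn_leq nm.
    case: n nm => [|n] nm; first by case: m nm => [|m] _; rewrite ?addn0 ?addn1.
    case: m nm => // m _ /=.
    have -> : (m.+1 + n.+1).+1 = (m + n + 3)%N by lia.
    by rewrite (exprD _ (m + n)) w3 mulr1.
  rewrite /phi exprS !rmorphD/= rmorphXn/= rmorph_nat rmorph1.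
  ring.
- by rewrite mulr_ge0 ?ltW ?weight_gt0.
Qed.

End Eigenvalues.

(** * Plane waves with a cutoff *)

Section PlaneWaves.
Variables (R : realType) (K : finFieldType).
Local Notation C := R[i].
Local Notation q := (#|K|%:R : R).
Local Notation Q := (#|K|%:R : C).

(** The growth [q^m] balances the weight, which is of order [q^(-2 m)] against the squared
    modulus. *)
Definition wave (s1 s2 : C) (chi : nat -> nat -> C) (m n : nat) : C :=
  (Q * s1) ^+ m * s2 ^+ n * chi m n.

Lemma wave_residual_interior (s1 s2 s3 : C) chi m n : s1 * s2 * s3 = 1 ->
  (n < m)%N ->
  Ahat K (wave s1 s2 chi) m.+1 n.+1 -
    Q * (s1 + s2 + s3) * wave s1 s2 chi m.+1 n.+1 =
  (Q * s1) ^+ m.+1 * s2 ^+ n.+1 * (Q * (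
    s1 * (chi m.+2 n.+1 - chi m.+1 n.+1) +
    s2 * (chi m.+1 n.+2 - chi m.+1 n.+1) +
    s3 * (chi m n - chi m.+1 n.+1))).
Proof.
move=> s123 nm; rewrite /Ahat /wave ltnS nm /=; move: Q => r.
(* Inserting [s1 s2 s3 = 1] supplies the missing factors [s1] and [s2] and leaves [s3] as the
   coefficient of the diagonal step. *)
have -> : (r * s1) ^+ m * s2 ^+ n * chi m n =
    (r * s1) ^+ m * s2 ^+ n * (s1 * s2 * s3) * chi m n by rewrite s123 mulr1.
rewrite !exprS; ring.
Qed.

(** On the wall the steps with multiplicities [q] and [q^2] both lead to [n = 1], giving
    [q (1 + q) s2] in place of [q (s2 + s3)]; the discrepancy is the last term. *)
Lemma wave_residual_wall (s1 s2 s3 : C) chi m :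
  Ahat K (wave s1 s2 chi) m.+1 0 -
    Q * (s1 + s2 + s3) * wave s1 s2 chi m.+1 0 =
  (Q * s1) ^+ m.+1 * (Q * (
    s1 * (chi m.+2 0 - chi m.+1 0) +
    (1 + Q) * s2 * (chi m.+1 1 - chi m.+1 0) +
    (Q * s2 - s3) * chi m.+1 0)).
Proof.
by rewrite /Ahat /wave /=; move: Q => r; rewrite !exprS !expr0; ring.
Qed.

End PlaneWaves.

(** Compares the upper bound for the residual with the lower bound for the wave when the tent has
    width [2 j]. The true ratio is of order [1 / j^2]; one factor [1 / j] is given away to simplify
    the constant. *)
Lemma residual_ratio (R : realFieldType) (j : nat) (A c g g' : R) : (0 < j)%N ->
  0 <= A -> 0 < g -> g' <= 6 * g ->
  (2 * (2 * j)).+1%:R * (A * (c / (2 * j)%:R) ^+ 2 * g') <=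
  96 * (A * c ^+ 2) / j%:R * (j.+1%:R * (16^-1 * g)).
Proof.
move=> j0 A0 g0 gg'; have jle : (2 * (2 * j)).+1%:R <= 4 * j.+1%:R :> R.
  by rewrite -natrM ler_nat; lia.
have jR : 1 <= j%:R :> R by rewrite ler1n.
have jn0 : j%:R != 0 :> R by rewrite pnatr_eq0 -lt0n.
set L := A * c ^+ 2; have L0 : 0 <= L by rewrite mulr_ge0 ?sqr_ge0.
have LE : A * (c / (2 * j)%:R) ^+ 2 = L / (4 * j%:R ^+ 2) by rewrite /L natrM; field.
have B0 : 0 <= L / (4 * j%:R ^+ 2) by rewrite divr_ge0// mulr_ge0// exprn_ge0.
rewrite LE; apply: (@le_trans _ _ (4 * j.+1%:R * (L / (4 * j%:R ^+ 2) * (6 * g)))).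
  have gB : L / (4 * j%:R ^+ 2) * g' <= L / (4 * j%:R ^+ 2) * (6 * g).
    exact: ler_wpM2l.
  apply: (@le_trans _ _ ((2 * (2 * j)).+1%:R * (L / (4 * j%:R ^+ 2) * (6 * g)))).
    exact: ler_wpM2l.
  by apply: ler_wpM2r => //; rewrite mulr_ge0// mulr_ge0// ltW.
have -> : 4 * j.+1%:R * (L / (4 * j%:R ^+ 2) * (6 * g)) =
    (96 * L / j%:R * (j.+1%:R * (16^-1 * g))) / j%:R by field.
rewrite ler_pdivrMr ?ltr0n// ler_peMr//.
apply: mulr_ge0; first by rewrite divr_ge0// mulr_ge0.
by rewrite mulr_ge0// mulr_ge0// ?invr_ge0// ltW.
Qed.

(** * Norm estimates for the truncated waves *)

Section ApproximateEigenvectors.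
Variables (R : realType) (K : finFieldType).
Local Notation C := R[i].
Local Notation q := (#|K|%:R : R).
Local Notation Q := (#|K|%:R : C).
Variables (s1 s2 s3 : C) (wall : bool) (k : nat).
Hypotheses (s123 : s1 * s2 * s3 = 1) (s1_1 : normc s1 = 1) (s2_1 : normc s2 <= 1).
Hypothesis s2s3 : wall -> Q * s2 = s3.
Hypothesis s2_1e : ~~ wall -> normc s2 = 1.
Hypothesis k_gt0 : (0 < k)%N.

Let N : R := k%:R.
(* For waves along the wall [n = 0] the tent in [n] is centred on the wall; the
   other waves decay nowhere and are kept away from both walls. *)
Let ctr : nat := if wall then 0 else (2 * k)%N.
(** The centre [6 k] puts the support in [5 k < m < 7 k], whereas [v] lives on [n < 3 k]; the wall
    [n = m] is thus avoided. *)
Let u (m : nat) : R := tent N (6 * k)%:R m%:R.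
Let v (n : nat) : R := tent N ctr%:R n%:R.
Let chi m n : C := (u m * v n)%:C%C.
Let phi := wave K s1 s2 chi.
Let err m n : C := Ahat K phi m n - Q * (s1 + s2 + s3) * phi m n.
Let c0 : R := q * (2 + q + 2 * normc s3).
(** After the weight has cancelled the growth in [m], the squared modulus of the wave behaves like
    [rho^n]. *)
Let rho : R := normc s2 ^+ 2.

Let N0 : 0 < N. Proof. by rewrite ltr0n. Qed.

Let u_supp m : (m <= 5 * k)%N || (7 * k <= m)%N -> u m = 0.
Proof.
move=> H; apply: tent_supp => //; rewrite /N.
have [le|le] := leqP m (6 * k).
  rewrite distrC -natrB// ger0_norm// ler_nat; lia.
rewrite -natrB ?(ltnW le)// ger0_norm// ler_nat; lia.
Qed.

Let v_supp n : (3 * k <= n)%N -> v n = 0.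
Proof.
move=> H; apply: tent_supp => //; rewrite /N.
have cn : (ctr + k <= n)%N by rewrite /ctr; case: wall; lia.
rewrite -natrB; last by lia.
by rewrite ger0_norm// ler_nat; lia.
Qed.

Let chi0 m n : (m <= n.+1)%N -> chi m n = 0.
Proof.
move=> mn; rewrite /chi; have [n3|n3] := leqP (3 * k) n.
  by rewrite v_supp// mulr0.
by rewrite u_supp ?mul0r//; lia.
Qed.

Let v0 : ~~ wall -> v 0 = 0.
Proof.
move=> w; apply: tent_supp => //; rewrite sub0r normrN ger0_norm// ler_nat /ctr.
by rewrite (negbTE w); lia.
Qed.

Let chi_lip m n m' n' (d : nat) :
  `|m%:R - m'%:R : R| + `|n%:R - n'%:R| <= d%:R ->
  normc (chi m n - chi m' n') <= d%:R / N.
Proof.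
move=> md; rewrite /chi -rmorphB normc_real.
have -> : u m * v n - u m' * v n' = (u m - u m') * v n + u m' * (v n - v n') by ring.
apply: (le_trans (ler_normD _ _)).
rewrite !normrM [`|v n|]ger0_norm ?tent_ge0// [`|u m'|]ger0_norm ?tent_ge0//.
apply: (@le_trans _ _ (`|u m - u m'| + `|v n - v n'|)).
  by apply: lerD; [rewrite ler_piMr ?tent_le1|rewrite ler_piMl ?tent_le1].
apply: (@le_trans _ _ ((`|m%:R - m'%:R| + `|n%:R - n'%:R|) / N)).
  by rewrite mulrDl; apply: lerD; apply: tent_lip.
by rewrite ler_pM2r ?invr_gt0.
Qed.

Let dist1 (n : nat) : `|n.+1%:R - n%:R : R| = 1.
Proof. by rewrite -natrB// subSnn normr1. Qed.

Let chi_m m n : normc (chi m.+1 n - chi m n) <= 1 / N.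
Proof. by apply: (@chi_lip _ _ _ _ 1); rewrite dist1 subrr normr0 addr0. Qed.

Let chi_n m n : normc (chi m n.+1 - chi m n) <= 1 / N.
Proof. by apply: (@chi_lip _ _ _ _ 1); rewrite dist1 subrr normr0 add0r. Qed.

Let chi_d m n : normc (chi m n - chi m.+1 n.+1) <= 2 / N.
Proof. by apply: (@chi_lip _ _ _ _ 2); rewrite !(distrC _ _.+1%:R) !dist1. Qed.

Let normc_wave m n (z : C) : normc ((Q * s1) ^+ m * s2 ^+ n * z) =
  q ^+ m * normc s2 ^+ n * normc z.
Proof. by rewrite !normcM !normcX normcM normc_nat s1_1 mulr1. Qed.

Let q0 : 0 <= q. Proof. by []. Qed.

(** The residual only involves differences of the cutoff over one step, each at most [2 / N]. The
    constant [c0] covers both the wall, with [1 + (1 + q)], and the interior, with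
    [1 + 1 + 2 |s3|]. *)
Let err_bound m n : (n <= m)%N ->
  normc (err m n) <= q ^+ m * normc s2 ^+ n * (c0 / N).
Proof.
have pos : 0 <= q ^+ m * normc s2 ^+ n by rewrite mulr_ge0 ?exprn_ge0 ?normc_ge0.
have iN : 0 <= N^-1 by rewrite invr_ge0 ltW.
have s3_0 := normc_ge0 s3.
rewrite leq_eqVlt => /orP[/eqP nm|].
  rewrite /err (_ : _ - _ = 0) ?normc0.
    apply: mulr_ge0 pos _; apply: mulr_ge0 iN; apply: mulr_ge0 => //.
    by rewrite !addr_ge0// mulr_ge0.
  rewrite /Ahat /phi /wave nm ltnn.
  rewrite (@chi0 m.+1 m)// (@chi0 m m)// ?leqW// !mulr0 subr0 addr0 add0r.
  case: m {nm pos} => [|m] /=; first by rewrite chi0// !mulr0.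
  by rewrite chi0// !mulr0.
case: m pos => // m pos; case: n pos => [|n] pos nm.
  rewrite /err wave_residual_wall normcM normcX normcM normc_nat s1_1 mulr1 expr0 mulr1.
  rewrite expr0 mulr1 in pos.
  rewrite ler_wpM2l// normcM normc_nat /c0 -[leRHS]mulrA ler_wpM2l//.
  (* Either the wave satisfies the wall equation [q s2 = s3], or the cutoff vanishes at [n = 0]. *)
  have -> : (Q * s2 - s3) * chi m.+1 0 = 0.
    case: (boolP wall) => w; first by rewrite s2s3// subrr mul0r.
    by rewrite /chi v0// mulr0 mulr0.
  rewrite addr0; apply: (le_trans (normcD _ _)); rewrite !normcM s1_1 mul1r.
  apply: (@le_trans _ _ (1 / N + (1 + q) * (1 / N))); last first.
    rewrite !mul1r -[X in X + _]mul1r -mulrDl ler_wpM2r//; lra.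
  apply: lerD; first exact: chi_m.
  apply: ler_pM; rewrite ?mulr_ge0 ?normc_ge0//; last exact: chi_n.
  apply: (@le_trans _ _ ((1 + q) * 1)); last by rewrite mulr1.
  apply: ler_pM; rewrite ?normc_ge0//.
  by rewrite (le_trans (normcD _ _))// normc1 normc_nat.
rewrite /err /phi wave_residual_interior// normc_wave ler_wpM2l//.
rewrite normcM normc_nat /c0 -[leRHS]mulrA ler_wpM2l//.
apply: (le_trans (normcD _ _)); apply: (@le_trans _ _ (2 / N + normc s3 * (2 / N))).
  apply: lerD; last by rewrite normcM ler_wpM2l//; exact: chi_d.
  apply: (le_trans (normcD _ _)); rewrite !normcM s1_1 mul1r.
  rewrite (_ : 2 / N = 1 / N + 1 * (1 / N)); last by field; rewrite gt_eqF.
  apply: lerD; first exact: chi_m.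
  by apply: ler_pM; rewrite ?normc_ge0//; exact: chi_n.
rewrite mulrA -mulrDl ler_wpM2r//; have := ler0n R #|K|; lra.
Qed.

(** The operator moves each coordinate by at most one, and the tents already vanish at [5 k], [7 k]
    and [3 k], so the residual stays in the closed box. *)
Let err_supp m n : (n <= m)%N ->
  ~~ [&& 5 * k <= m, m <= 7 * k & n <= 3 * k]%N -> err m n = 0.
Proof.
move=> nm H; have uv i j : (m <= i.+1)%N -> (i <= m.+1)%N -> (n <= j.+1)%N ->
    u i * v j = 0.
  move=> mi im nj; have [n3|n3] := leqP (3 * k) j; first by rewrite v_supp// mulr0.
  rewrite u_supp ?mul0r//; lia.
have chiz i j : (m <= i.+1)%N -> (i <= m.+1)%N -> (n <= j.+1)%N -> phi i j = 0.
  by move=> mi im nj; rewrite /phi /wave /chi uv// mulr0.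
have -> : err m n = Q * (if (n < m)%N then phi m n.+1 else phi m.+1 m) +
    Q ^+ 2 * (if n is n'.+1 then phi m.-1 n' else
              if m == 0%N then phi 1 0 else phi m 1).
  rewrite /err /Ahat (chiz m n) ?leqnSn// (chiz m.+1 n) ?leqnSn//; last by lia.
  by rewrite mulr0 subr0 add0r.
have -> : (if (n < m)%N then phi m n.+1 else phi m.+1 m) = 0.
  by case: ifP => _; apply: chiz; lia.
rewrite mulr0 add0r.
case: n nm {H uv} chiz => [|n] nm chiz; last by rewrite chiz ?mulr0//; lia.
case: eqP => [m0|_]; rewrite chiz ?mulr0//; lia.
Qed.

Let weighted m n (x y : R) : (n <= m)%N -> (0 < m)%N -> 0 <= x ->
  x <= q ^+ m * normc s2 ^+ n * y ->
  x ^+ 2 * weight R K m n <= (q + 1) * y ^+ 2 * rho ^+ n.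
Proof.
move=> nm m0 x0 xy; have qm : q ^+ (2 * m) != 0.
  by rewrite gt_eqF// exprn_gt0// (lt_le_trans _ (q_ge2 R K)).
apply: (@le_trans _ _ ((q ^+ m * normc s2 ^+ n * y) ^+ 2 * ((q + 1) / q ^+ (2 * m)))).
  apply: ler_pM; rewrite ?sqr_ge0 ?(ltW (weight_gt0 _ _ _ _))//.
    by rewrite ler_sqr ?nnegrE// (le_trans x0).
  exact: weight_le.
have -> : rho ^+ n = (normc s2 ^+ n) ^+ 2 by rewrite /rho -!exprM mulnC.
have qE : q ^+ (2 * m) = (q ^+ m) ^+ 2 by rewrite mulnC exprM.
rewrite le_eqVlt; apply/orP; left; apply/eqP; rewrite qE; field.
by move: qm; rewrite qE expf_eq0.
Qed.

Let rho_ge0 : 0 <= rho. Proof. exact: sqr_ge0. Qed.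

Let rho_le1 : rho <= 1.
Proof. by rewrite expr_le1// normc_ge0. Qed.

Let box := [seq (m, n) | m <- iota (5 * k) (2 * k).+1, n <- iota 0 (3 * k).+1].

Let boxP m n : ((m, n) \in box) = [&& 5 * k <= m, m <= 7 * k & n <= 3 * k]%N.
Proof.
apply/allpairsP/idP => [[[i j]] [+ + [-> ->]]|H].
  by rewrite !mem_iota [(i, j).1]/= [(i, j).2]/=; lia.
exists (m, n); rewrite !mem_iota [(m, n).1]/= [(m, n).2]/=.
by split; [lia|lia|].
Qed.

Let G (j : nat) : R := \sum_(n <- iota 0 j) rho ^+ n.

Let sqnorm_err :
  (sqnorm (fun X => Aw_plus (of_vmn (K := K) phi) X -
     Q * (s1 + s2 + s3) * of_vmn phi X)%R <=
   (((2 * k).+1)%:R * ((q + 1) * (c0 / N) ^+ 2 * G (3 * k).+1))%:E)%E.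
Proof.
rewrite sqnorm_residual.
pose b (p : nat * nat) := (q + 1) * (c0 / N) ^+ 2 * rho ^+ p.2.
have b0 p : 0 <= b p.
  apply: mulr_ge0; last exact: exprn_ge0.
  by apply: mulr_ge0; [exact: addr_ge0|exact: sqr_ge0].
apply: (@le_trans _ _ (\sum_(p <- box) b p)%:E).
  apply: esum_le_supp => [//|[m n] /= nm|[m n] /= nm]; rewrite -/(err m n).
    by rewrite boxP => H; rewrite err_supp// normc0 expr0n mul0r.
  case: (boolP ((m, n) \in box)); rewrite boxP => H.
    apply: weighted => //; [|exact: normc_ge0|exact: err_bound].
    by case/and3P: H; lia.
  by rewrite err_supp// normc0 expr0n mul0r b0.
have -> : \sum_(p <- box) b p = \sum_(m <- iota (5 * k) (2 * k).+1)
    ((q + 1) * (c0 / N) ^+ 2 * G (3 * k).+1).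
  by rewrite big_allpairs; apply: eq_bigr => m _; rewrite /G mulr_sumr.
by rewrite lee_fin big_const_seq count_predT size_iota iter_addr_0 mulr_natl.
Qed.

Let sqnorm_phi_fin : (sqnorm (of_vmn (K := K) phi) < +oo)%E.
Proof.
rewrite sqnorm_of_vmn.
pose b (p : nat * nat) := normc (phi p.1 p.2) ^+ 2 * weight R K p.1 p.2.
have b0 p : 0 <= b p by apply: mulr_ge0; [exact: sqr_ge0|exact/ltW/weight_gt0].
apply: (@le_lt_trans _ _ (\sum_(p <- box) b p)%:E); last exact: ltry.
apply: esum_le_supp => // -[m n] /= nm; rewrite boxP => H.
suff -> : phi m n = 0 by rewrite normc0 expr0n mul0r.
rewrite /phi /wave /chi; have [n3|n3] := leqP (3 * k) n.
  by rewrite v_supp// mulr0 mulr0.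
by rewrite u_supp ?mul0r ?mulr0//; lia.
Qed.

(** Within distance [j = N / 2] of the centres both tents are at least 1/2, so the squared cutoff is
    at least 1/16. *)
Let sqnorm_phi j : k = (2 * j)%N ->
  ((j.+1%:R * (16^-1 * G j.+1))%:E <= sqnorm (of_vmn (K := K) phi))%E.
Proof.
move=> kj; rewrite sqnorm_of_vmn.
pose s := [seq (m, n) | m <- iota (6 * k) j.+1, n <- iota ctr j.+1].
have ctr2 : (ctr <= 2 * k)%N by rewrite /ctr; case: wall.
have sP m n : (m, n) \in s -> [/\ 6 * k <= m, m <= 6 * k + j, ctr <= n & n <= ctr + j]%N.
  move=> /allpairsP[[a b]] [+ + [-> ->]].
  rewrite !mem_iota [(a, b).1]/= [(a, b).2]/= => /andP[a1 a2] /andP[b1 b2].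
  by split=> //; lia.
apply: le_trans (@esum_ge_seq R _ _ _ s _ _); last 2 first.
- by apply: allpairs_uniq; rewrite ?iota_uniq// => -[a b] [a' b'].
- by move=> -[m n] /sP[] /=; lia.
have -> : j.+1%:R * (16^-1 * G j.+1) = \sum_(p <- s) 16^-1 * rho ^+ p.2.
  (* For waves along the wall the centre is 0; for the others [rho = 1], so the starting point of
     the sum is immaterial. *)
  have GE : G j.+1 = \sum_(n <- iota ctr j.+1) rho ^+ n.
    rewrite /G /ctr; case: (boolP wall) => // w.
    have rho1 n : rho ^+ n = 1 by rewrite /rho s2_1e// !expr1n.
    have sum1 i : \sum_(n <- iota i j.+1) rho ^+ n = \sum_(n <- iota i j.+1) 1.
      by apply: eq_bigr => n _; exact: rho1.
    by rewrite (sum1 0%N) (sum1 (2 * k)%N) !big_const_seq !count_predT !size_iota.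
  transitivity (\sum_(m <- iota (6 * k) j.+1) (16^-1 * G j.+1)).
    by rewrite big_const_seq count_predT size_iota iter_addr_0 mulr_natl.
  by rewrite big_allpairs; apply: eq_bigr => m _; rewrite GE mulr_sumr.
rewrite lee_fin big_seq [leRHS]big_seq; apply: ler_sum => -[m n] /sP[m1 m2 n1 n2] /=.
have um : 2^-1 <= u m.
  by apply: tent_half => //; rewrite -natrB// ger0_norm// /N kj natrM mulrC mulKf// ler_nat; lia.
have vn : 2^-1 <= v n.
  by apply: tent_half => //; rewrite -natrB// ger0_norm// /N kj natrM mulrC mulKf// ler_nat; lia.
rewrite /phi /wave normc_wave normc_real ger0_norm ?mulr_ge0 ?tent_ge0//.
have m_gt0 : (0 < m)%N by apply: leq_trans m1; rewrite muln_gt0.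
have qm : q ^+ m != 0.
  by rewrite gt_eqF// exprn_gt0// (lt_le_trans _ (q_ge2 R K)).
apply: (@le_trans _ _ ((q ^+ m * normc s2 ^+ n * (u m * v n)) ^+ 2 / q ^+ (2 * m))).
  have -> : (q ^+ m * normc s2 ^+ n * (u m * v n)) ^+ 2 / q ^+ (2 * m) =
      rho ^+ n * (u m ^+ 2 * v n ^+ 2).
    have -> : rho ^+ n = (normc s2 ^+ n) ^+ 2 by rewrite /rho -!exprM mulnC.
    by rewrite (mulnC 2) exprM; field.
  rewrite [leLHS]mulrC ler_wpM2l ?exprn_ge0 ?normc_ge0//.
  rewrite (_ : 16^-1 = 2^-1 ^+ 2 * 2^-1 ^+ 2 :> R); last by field.
  by apply: ler_pM; rewrite ?exprn_ge0 ?invr_ge0// lerXn2r ?nnegrE ?invr_ge0 ?tent_ge0.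
by rewrite ler_wpM2l ?sqr_ge0// weight_ge.
Qed.

(** Since [rho <= 1], the partial sums are subadditive in their length, and [6 j + 1 <= 6 (j + 1)].
    This serves bounded and linearly growing sums alike. *)
Let G_le j : G (3 * (2 * j)).+1 <= 6 * G j.+1.
Proof.
have G_cat a b : G (a + b) <= G a + G b.
  rewrite /G iotaD big_cat /= lerD2l add0n -[X in iota X _]addn0 iotaDl big_map.
  by apply: ler_sum => n _; rewrite ler_wiXn2l// leq_addl.
have G_mul a c : G (c * a) <= c%:R * G a.
  elim: c => [|c IHc]; first by rewrite mul0n /G big_nil mul0r.
  by rewrite mulSn (le_trans (G_cat _ _))// mulrS mulrDl mul1r lerD2l.
apply: le_trans (G_mul j.+1 6); rewrite /G.
apply: ler_sum_sub => [|n|n]; [exact: iota_uniq| |exact: exprn_ge0].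
by rewrite !mem_iota; lia.
Qed.

Lemma approximate_eigenvector j : k = (2 * j)%N -> exists f, exists M1 M2 : R,
  [/\ 0 < M1, (M1%:E <= sqnorm f < +oo)%E,
    (sqnorm (fun X => @Aw_plus K C f X - Q * (s1 + s2 + s3) * f X)%R <= M2%:E)%E &
    M2 <= 96 * ((q + 1) * (q * (2 + q + 2 * normc s3)) ^+ 2) / j%:R * M1].
Proof.
move=> kj; have j0 : (0 < j)%N by move: k_gt0; rewrite kj; lia.
have G0 : 0 < G j.+1.
  rewrite /G /= big_cons expr0 ltr_pwDl//; apply: sumr_ge0 => n _.
  exact: exprn_ge0.
exists (of_vmn phi), (j.+1%:R * (16^-1 * G j.+1)); eexists; split.
- by rewrite !mulr_gt0// invr_gt0.
- by apply/andP; split; [exact: sqnorm_phi|exact: sqnorm_phi_fin].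
- exact: sqnorm_err.
rewrite /N -/c0 kj; apply: (residual_ratio c0 j0 _ G0 (G_le j)).
exact: addr_ge0.
Qed.

End ApproximateEigenvectors.

(** * The spectral sets *)

Lemma plane_wave_spectrum (R : realType) (K : finFieldType) (s1 s2 s3 : R[i]) :
  s1 * s2 * s3 = 1 -> normc s1 = 1 -> normc s2 <= 1 ->
  #|K|%:R * s2 = s3 \/ normc s2 = 1 ->
  spectrum (@Aw_plus K R[i]) (#|K|%:R * (s1 + s2 + s3)).
Proof.
move=> s123 n1 n2 s2P; apply: approx_eigenvalue => e e0.
have [wall [W1 W2]] : exists wall : bool,
    (wall -> #|K|%:R * s2 = s3) /\ (~~ wall -> normc s2 = 1).
  by case: s2P => H; [exists true|exists false].
pose kappa : R := 96 * ((#|K|%:R + 1) * (#|K|%:R * (2 + #|K|%:R + 2 * normc s3)) ^+ 2).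
have kappa0 : 0 <= kappa.
  apply: mulr_ge0 => //; apply: mulr_ge0; last exact: sqr_ge0.
  exact: addr_ge0.
(* The ratio of the squared norms is at most [kappa / j], so a wide enough tent brings it below
   [e]. *)
pose j := (Num.bound (kappa / e)).+1.
have j0 : 0 < j%:R :> R by rewrite ltr0n.
have je : kappa / j%:R <= e.
  rewrite ler_pdivrMr// mulrC -ler_pdivrMr// ltW//.
  apply: (lt_le_trans (archi_boundP _)); first exact/divr_ge0/ltW.
  by rewrite ler_nat.
have k0 : (0 < 2 * j)%N by [].
have [f [M1 [M2 [M10 M1f fM2 M21]]]] :=
  approximate_eigenvector s123 n1 n2 W1 W2 k0 erefl.
exists f, M1, M2; split=> //.
by apply: (le_trans M21); rewrite ler_pM2r.
Qed.

Theorem theorem1p1 (R : realType) (K : finFieldType) :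
  let q : R := #|K|%:R in
  Sigma0 q `|` Sigma1 q `|` Sigma2 q `<=` spectrum (@Aw_plus K R[i]).
Proof.
move=> q.
have q0 : 0 < q := lt_le_trans (ltr0n _ 2) (q_ge2 R K).
have qC : q%:C%C = #|K|%:R :> R[i] by rewrite rmorph_nat.
move=> z [[|]|].
- have cis3 (a : R) : cis a ^+ 3 = cis (a + a + a) by rewrite !cisD !exprS expr0 mulr1 mulrA.
  case=> ->.
  + have := @Sigma0_spectrum R K 1; rewrite mulr1 expr1n; apply=> //.
    exact: normc1.
  + apply: Sigma0_spectrum; last exact: normc_cis.
    by rewrite cis3 -[RHS](@cis2pi R); congr cis; field.
  + apply: Sigma0_spectrum; last exact: normc_cis.
    rewrite cis3 (_ : _ + _ + _ = 2 * trigo.pi + 2 * trigo.pi :> R); last by field.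
    by rewrite cisD cis2pi mulr1.
- case=> theta ->; pose r := q `^ (1 / 2).
  have r0 : 0 < r by exact: powR_gt0.
  have rr : r * r = q.
    by rewrite -powRD ?gt_eqF ?implybT// -splitr powRr1// ltW.
  have q32 : q `^ (3 / 2) = q * r.
    rewrite (_ : 3 / 2 = 1 + 1 / 2); last by field.
    by rewrite powRD ?gt_eqF ?implybT// powRr1// ltW.
  have rC0 : r%:C%C != 0 :> R[i] by rewrite (fmorph_eq0 (real_complex R)) gt_eqF.
  have qrr : #|K|%:R = r%:C%C * r%:C%C :> R[i] by rewrite -qC -rr rmorphM.
  have q32C : (q `^ (3 / 2))%:C%C = r%:C%C * r%:C%C * r%:C%C :> R[i].
    by rewrite q32 -rr !rmorphM.
  have r1 : 1 <= r.
    rewrite -(@ler_sqr R) ?nnegrE ?(ltW r0)// expr1n expr2 rr.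
    by apply: le_trans (q_ge2 R K); rewrite ler1n.
  (* The point is [q (s1 + s2 + s3)] with [s1 = cis (- 2 theta)], [s2 = q^(-1/2) cis theta] and
     [s3 = q^(1/2) cis theta], which satisfy [q s2 = s3]. *)
  have -> : (q `^ (3 / 2))%:C%C * cis theta + q%:C%C * cis (- 2 * theta) +
      (q `^ (1 / 2))%:C%C * cis theta =
      #|K|%:R * (cis (- 2 * theta) + r%:C%C^-1 * cis theta + r%:C%C * cis theta).
    rewrite -/r q32C qC qrr; field; exact: rC0.
  apply: plane_wave_spectrum.
  + rewrite mulrACA mulrA; transitivity (cis (- 2 * theta) * (cis theta * cis theta)).
      by field; exact: rC0.
    by rewrite -!cisD -[RHS](@cis0 R); congr cis; ring.
  + exact: normc_cis.
  + by rewrite normcM normc_cis mulr1 normcV normc_real gtr0_norm// invf_le1.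
  + by left; rewrite qrr mulrA mulfK.
- case=> s1 [s2 [s3 [s123 /norm1_normc n1 /norm1_normc n2 _ ->]]].
  rewrite qC; apply: plane_wave_spectrum => //; first by rewrite n2.
  by right.
Qed.
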